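(* Let $Z$ be a compact space endowed with a continuous action of $\mathbb T \rtimes \mathbb Z_2$ such that the action of $\mathbb T$ is free. There exists a bijection between the set of quantum subspaces $X \subset Z_{\mathbb R,*}$ and the set of pairs $(E,F)$ where 1. $E \subset Z_{{\rm reg}}$ is $\mathbb T \rtimes \mathbb Z_2$-stable and $E= \overline{E} \cap Z_{{\rm reg}}$ (i.e. $E$ is closed in $Z_{\rm reg}$); 2. $F \subset Z_{\mathbb R}$ is closed and satisfies $\overline{E}\cap Z_{\mathbb R} \subset F$. Moreover the quantum subspace $X$ is non-classical if and only if, in the corresponding pair $(E,F)$, we have $E \not=\emptyset$.
   Context: All $C^*$-algebras and $C^*$-algebra maps are unital; compact spaces are Hausdorff; ideals of $C^*$-algebras are closed and two-sided (the whole algebra is allowed, corresponding to the empty subspace). $\mathbb T$ is the group of complex numbers of modulus one, and $\mathbb T\rtimes\mathbb Z_2$ is the semi-direct product for the conjugation action of $\mathbb Z_2$ on $\mathbb T$. For $Z$ as in the claim, $\tau$ denotes the order two homeomorphism of $Z$ given by the generator of the second factor $\mathbb Z_2$ (so $\tau(\omega z)=\overline{\omega}\tau(z)$ for $\omega \in \mathbb T$), and also the induced automorphism of $C(Z)$, $\tau(f)(z)=f(\tau(z))$. Put $$Z_{\mathbb R}=\{z\in Z : \tau(z)=z\},\quad Z_{\rm reg}=Z\setminus \mathbb T Z_{\mathbb R},$$ $$C(Z)^{\mathbb T}=\{f\in C(Z): f(\omega z)=f(z)\ \forall \omega\in\mathbb T,\ z\in Z\},\quad C_{\mathbb T}(Z)=\{f\in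 C(Z): f(\omega z)=\omega f(z)\ \forall \omega\in\mathbb T,\ z\in Z\}.$$ The crossed product $C(Z)\rtimes\mathbb Z_2$ (with respect to $\tau$) consists of elements $f_0\otimes 1+f_1\otimes\tau$, $f_0,f_1\in C(Z)$, with $(f\otimes\tau)(g\otimes 1)=f\tau(g)\otimes\tau$, $(f\otimes\tau)(g\otimes\tau)=f\tau(g)\otimes1$, $(f\otimes\tau)^*=\tau(f^* )\otimes\tau$, and $f\mapsto f\otimes 1$ the inclusion of $C(Z)$. The $C^*$-algebra $C(Z_{\mathbb R,*})$ is $$C(Z_{\mathbb R,*})= \{f_0 \otimes 1 + f_1\otimes \tau : f_0 \in C(Z)^{\mathbb T},\ f_1 \in C_{\mathbb T}(Z)\}\subset C(Z)\rtimes \mathbb Z_2,$$ viewed as the algebra of continuous functions on a quantum space $Z_{\mathbb R,*}$. A quantum subspace $X\subset Z_{\mathbb R,*}$ is a quotient $C(X)$ of $C(Z_{\mathbb R,*})$ by an ideal (so quantum subspaces correspond to ideals of $C(Z_{\mathbb R,*})$); it is non-classical if $C(X)$ is non-commutative. Closures $\overline{E}$ are taken in $Z$. *)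

(* Defs.v *)
From HB Require Import structures.
From mathcomp Require Import all_boot all_order all_algebra.
From mathcomp Require Import all_classical all_reals.
From mathcomp Require Import topology normedtype.
From mathcomp Require Import complex ring lra.
Import Order.TTheory GRing.Theory Num.Theory.
Import numFieldNormedType.Exports.

Set Implicit Arguments.
Unset Strict Implicit.
Unset Printing Implicit Defensive.

Local Open Scope classical_set_scope.
Local Open Scope ring_scope.
Local Open Scope complex_scope.

(* R[i]^o rather than R[i]: the library puts the norm topology on K^o. *)
Notation Cplx R := (R[i]^o).

Section CircleGroup.
Variable R : realType.

Definition circle_set : set (Cplx R) := [set w | `|w| = 1].

Definition circle : Type := set_type circle_set.

HB.instance Definition _ := Choice.on circle.
HB.instance Definition _ := Topological.copy circle (set_type circle_set).

Definition circle_val (w : circle) : R[i] := set_val w.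

Lemma circle_valE (w : circle) : `|circle_val w| = 1.
Proof. by case: w => w wP; exact: (set_mem wP). Qed.

Lemma circle_val_inj : injective circle_val.
Proof. exact: val_inj. Qed.

Definition mk_circle (w : R[i]) (hw : `|w| = 1) : circle :=
  exist _ w (mem_set (hw : circle_set w)).

Lemma circle_one_subproof : `|1 : R[i]| = 1. Proof. exact: normr1. Qed.

Lemma circle_mul_subproof (v w : circle) : `|circle_val v * circle_val w| = 1.
Proof. by rewrite normrM !circle_valE mulr1. Qed.

Lemma circle_conj_subproof (w : circle) : `|(circle_val w)^*%C| = 1.
Proof. by rewrite normcJ circle_valE. Qed.

Definition circle_one : circle := mk_circle circle_one_subproof.
Definition circle_mul (v w : circle) : circle :=
  mk_circle (circle_mul_subproof v w).
Definition circle_conj (w : circle) : circle :=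
  mk_circle (circle_conj_subproof w).

Lemma circle_mulA : associative circle_mul.
Proof. by move=> u v w; apply: circle_val_inj; apply: mulrA. Qed.

Lemma circle_mulC : commutative circle_mul.
Proof. by move=> u v; apply: circle_val_inj; apply: mulrC. Qed.

Lemma circle_mul1 : left_id circle_one circle_mul.
Proof. by move=> w; apply: circle_val_inj; apply: mul1r. Qed.

Lemma circle_mulr1 : right_id circle_one circle_mul.
Proof. by move=> w; rewrite circle_mulC circle_mul1. Qed.

Lemma circle_mulV : left_inverse circle_one circle_conj circle_mul.
Proof.
move=> w; apply: circle_val_inj.
transitivity ((circle_val w)^*%C * circle_val w); first by [].
by rewrite mulrC -sqr_normc circle_valE expr1n.
Qed.

Lemma circle_mulVr : right_inverse circle_one circle_conj circle_mul.
Proof. by move=> w; rewrite circle_mulC circle_mulV. Qed.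

(* On the circle, complex conjugation is the group inverse. *)
HB.instance Definition _ := isGroup.Build circle
  circle_mulA circle_mul1 circle_mulr1 circle_mulV circle_mulVr.

Lemma circle_conjM (v w : circle) :
  circle_conj (v * w)%g = (circle_conj v * circle_conj w)%g.
Proof. by apply: circle_val_inj; apply: rmorphM. Qed.

Lemma circle_conj1 : circle_conj 1%g = 1%g.
Proof. by apply: circle_val_inj; apply: conjc1. Qed.

Lemma circle_conjK : involutive circle_conj.
Proof. by move=> w; apply: circle_val_inj; apply: conjcK. Qed.

(* The Booleans stand for Z/2, with addb as group law; (w, s) is the element
   w s of the semi-direct product. *)
Definition TZ2 : Type := (circle * bool)%type.

HB.instance Definition _ := Choice.on TZ2.
HB.instance Definition _ := Topological.copy TZ2 (circle * bool)%type.

Definition conj_if (s : bool) (w : circle) : circle :=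
  if s then circle_conj w else w.

Definition TZ2_one : TZ2 := (1%g, false).
Definition TZ2_mul (g h : TZ2) : TZ2 :=
  ((g.1 * conj_if g.2 h.1)%g, g.2 (+) h.2).
Definition TZ2_inv (g : TZ2) : TZ2 := (conj_if g.2 (g.1^-1)%g, g.2).

(* the generator of the factor Z/2 *)
Definition TZ2_flip : TZ2 := (1%g, true).

Lemma TZ2_mulA : associative TZ2_mul.
Proof.
move=> [u []] [v []] [w []]; rewrite /TZ2_mul /=;
  by rewrite ?circle_conjM ?circle_conjK ?mulgA.
Qed.

Lemma TZ2_mul1 : left_id TZ2_one TZ2_mul.
Proof. by move=> [w s]; rewrite /TZ2_mul /= mul1g. Qed.

Lemma TZ2_mulr1 : right_id TZ2_one TZ2_mul.
Proof. by move=> [w []]; rewrite /TZ2_mul /= ?circle_conj1 mulg1. Qed.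

Lemma TZ2_mulV : left_inverse TZ2_one TZ2_inv TZ2_mul.
Proof.
move=> [w []]; rewrite /TZ2_mul /TZ2_inv /= -?circle_conjM mulVg //.
by rewrite circle_conj1.
Qed.

Lemma TZ2_mulVr : right_inverse TZ2_one TZ2_inv TZ2_mul.
Proof. by move=> [w []]; rewrite /TZ2_mul /TZ2_inv /= ?circle_conjK mulgV. Qed.

HB.instance Definition _ := isGroup.Build TZ2
  TZ2_mulA TZ2_mul1 TZ2_mulr1 TZ2_mulV TZ2_mulVr.

End CircleGroup.

Record TZ2_space (R : realType) := TZ2Space {
  TZ2_carrier :> topologicalType;
  TZ2_compact : compact [set: TZ2_carrier];
  TZ2_hausdorff : hausdorff_space TZ2_carrier;
  TZ2_act : TZ2 R -> TZ2_carrier -> TZ2_carrier;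
  TZ2_act1 : forall z, TZ2_act 1%g z = z;
  TZ2_actM : forall g h z, TZ2_act (g * h)%g z = TZ2_act g (TZ2_act h z);
  TZ2_act_continuous :
    continuous (fun p : TZ2 R * TZ2_carrier => TZ2_act p.1 p.2)
}.
Arguments TZ2_act {R t}.

Section Action.
Variables (R : realType) (Z : TZ2_space R).

Definition circle_act (w : circle R) (z : Z) : Z := TZ2_act (w, false) z.
Definition tau (z : Z) : Z := TZ2_act (TZ2_flip R) z.

Definition free_circle_action : Prop :=
  forall (w : circle R) (z : Z), circle_act w z = z -> w = 1%g.

Lemma tauK : involutive tau.
Proof.
move=> z; rewrite /tau -TZ2_actM.
have -> : (TZ2_flip R * TZ2_flip R)%g = 1%g; last exact: TZ2_act1.
by rewrite -[LHS]/(TZ2_mul _ _) /TZ2_mul /= circle_conj1 mulg1.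
Qed.

Lemma tau_rot (w : circle R) (z : Z) :
  tau (circle_act w z) = circle_act (circle_conj w) (tau z).
Proof.
rewrite /tau /circle_act -!TZ2_actM; congr TZ2_act.
transitivity (TZ2_mul (TZ2_flip R) (w, false)); first by [].
transitivity (TZ2_mul (circle_conj w, false) (TZ2_flip R)); last by [].
by rewrite /TZ2_mul /= mul1g mulg1.
Qed.

Lemma tau_continuous : continuous tau.
Proof.
move=> z; apply: (@continuous_comp _ _ _ (fun z : Z => (TZ2_flip R, z))
  (fun p : TZ2 R * Z => TZ2_act p.1 p.2)); last exact: TZ2_act_continuous.
apply: (@cvg_pair _ _ _ (nbhs z) (nbhs (TZ2_flip R)) (nbhs z) _ _ _
  (fun=> TZ2_flip R) id); [exact: cvg_cst | exact: cvg_id].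
Qed.

Definition Z_real : set Z := [set z | tau z = z].
Definition Z_reg : set Z :=
  ~` [set z | exists (w : circle R) (x : Z), Z_real x /\ z = circle_act w x].

End Action.
Arguments circle_act {R Z} w z.
Arguments tau {R Z} z.
Arguments Z_real {R Z}.
Arguments Z_reg {R Z}.

Section ContinuousFunctions.
Variables (R : realType) (Z : TZ2_space R).

Definition CZ : Type := continuousType Z (Cplx R).
Definition CZ_fun (f : CZ) : Z -> R[i] := (f : continuousType Z (Cplx R)).
Coercion CZ_fun : CZ >-> Funclass.

HB.instance Definition _ := Choice.on CZ.

Definition mk_CZ (f : Z -> Cplx R) (hf : continuous f) : CZ :=
  (mkcts hf : continuousType Z (Cplx R)).

Lemma CZ_continuous (f : CZ) : continuous (f : Z -> Cplx R).
Proof. exact: cts_fun. Qed.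

Lemma CZ_ext (f g : CZ) : f =1 g -> f = g.
Proof. by move=> fg; apply/continuousEP. Qed.

Lemma CZ_cst_subproof (c : Cplx R) : continuous (fun _ : Z => c).
Proof. by move=> z; exact: cvg_cst. Qed.

Lemma CZ_add_subproof (f g : CZ) : continuous (fun z => f z + g z : Cplx R).
Proof. by move=> z; apply: cvgD; exact: CZ_continuous. Qed.

Lemma CZ_opp_subproof (f : CZ) : continuous (fun z => - f z : Cplx R).
Proof. by move=> z; apply: cvgN; exact: CZ_continuous. Qed.

Lemma CZ_mul_subproof (f g : CZ) : continuous (fun z => f z * g z : Cplx R).
Proof. by move=> z; apply: (@cvgM R[i]); exact: CZ_continuous. Qed.

Lemma CZ_conj_subproof (f : CZ) : continuous (fun z => (f z)^*%C : Cplx R).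
Proof.
move=> z; apply/cvgrPdist_lt => e e0.
have /cvgrPdist_lt /(_ e e0) := @CZ_continuous f z.
apply: filterS => t /=.
by rewrite -[X in X < e -> _](@normcJ R) rmorphB.
Qed.

Lemma CZ_tau_subproof (f : CZ) : continuous (fun z => f (tau z) : Cplx R).
Proof.
by move=> z; apply: continuous_comp; [exact: tau_continuous | exact: CZ_continuous].
Qed.

Definition CZ_cst (c : R[i]) : CZ := mk_CZ (@CZ_cst_subproof c).
Definition CZ_add (f g : CZ) : CZ := mk_CZ (@CZ_add_subproof f g).
Definition CZ_opp (f : CZ) : CZ := mk_CZ (@CZ_opp_subproof f).
Definition CZ_mul (f g : CZ) : CZ := mk_CZ (@CZ_mul_subproof f g).
Definition CZ_star (f : CZ) : CZ := mk_CZ (@CZ_conj_subproof f).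
Definition CZ_tau (f : CZ) : CZ := mk_CZ (@CZ_tau_subproof f).
Definition CZ_scale (c : R[i]) (f : CZ) : CZ := CZ_mul (CZ_cst c) f.

Lemma CZ_addA : associative CZ_add.
Proof. by move=> f g h; apply: CZ_ext => z; apply: addrA. Qed.
Lemma CZ_addC : commutative CZ_add.
Proof. by move=> f g; apply: CZ_ext => z; apply: addrC. Qed.
Lemma CZ_add0 : left_id (CZ_cst 0) CZ_add.
Proof. by move=> f; apply: CZ_ext => z; apply: add0r. Qed.
Lemma CZ_addN : left_inverse (CZ_cst 0) CZ_opp CZ_add.
Proof. by move=> f; apply: CZ_ext => z; apply: addNr. Qed.

HB.instance Definition _ :=
  GRing.isZmodule.Build CZ CZ_addA CZ_addC CZ_add0 CZ_addN.

Lemma CZ_mulA : associative CZ_mul.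
Proof. by move=> f g h; apply: CZ_ext => z; apply: mulrA. Qed.
Lemma CZ_mulC : commutative CZ_mul.
Proof. by move=> f g; apply: CZ_ext => z; apply: mulrC. Qed.
Lemma CZ_mul1 : left_id (CZ_cst 1) CZ_mul.
Proof. by move=> f; apply: CZ_ext => z; apply: mul1r. Qed.
Lemma CZ_mulr1 : right_id (CZ_cst 1) CZ_mul.
Proof. by move=> f; rewrite CZ_mulC CZ_mul1. Qed.
Lemma CZ_mulD : left_distributive CZ_mul +%R.
Proof. by move=> f g h; apply: CZ_ext => z; apply: mulrDl. Qed.
Lemma CZ_mulDr : right_distributive CZ_mul +%R.
Proof. by move=> f g h; apply: CZ_ext => z; apply: mulrDr. Qed.

HB.instance Definition _ := GRing.Zmodule_isPzRing.Build CZ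
  CZ_mulA CZ_mul1 CZ_mulr1 CZ_mulD CZ_mulDr.
HB.instance Definition _ := GRing.PzRing_hasCommutativeMul.Build CZ CZ_mulC.

Lemma CZ_scaleA a b f : CZ_scale a (CZ_scale b f) = CZ_scale (a * b) f.
Proof. by apply: CZ_ext => z; apply: mulrA. Qed.
Lemma CZ_scale1 : left_id 1 CZ_scale.
Proof. by move=> f; apply: CZ_ext => z; apply: mul1r. Qed.
Lemma CZ_scaleDr : right_distributive CZ_scale +%R.
Proof. by move=> a f g; apply: CZ_ext => z; apply: mulrDr. Qed.
Lemma CZ_scaleDl f : {morph CZ_scale^~ f : a b / a + b}.
Proof. by move=> a b; apply: CZ_ext => z; apply: mulrDl. Qed.

HB.instance Definition _ := GRing.Zmodule_isLmodule.Build R[i] CZ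
  CZ_scaleA CZ_scale1 CZ_scaleDr CZ_scaleDl.

Lemma CZ0E z : CZ_fun 0 z = 0. Proof. by []. Qed.
Lemma CZ1E z : CZ_fun 1 z = 1. Proof. by []. Qed.
Lemma CZDE (f g : CZ) z : CZ_fun (f + g) z = f z + g z. Proof. by []. Qed.
Lemma CZNE (f : CZ) z : CZ_fun (- f) z = - f z. Proof. by []. Qed.
Lemma CZME (f g : CZ) z : CZ_fun (f * g) z = f z * g z. Proof. by []. Qed.
Lemma CZZE a (f : CZ) z : CZ_fun (a *: f) z = a * f z. Proof. by []. Qed.
Lemma CZ_starE (f : CZ) z : CZ_fun (CZ_star f) z = (f z)^*%C. Proof. by []. Qed.
Lemma CZ_tauE (f : CZ) z : CZ_fun (CZ_tau f) z = f (tau z). Proof. by []. Qed.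
Definition CZE := (CZ0E, CZ1E, CZDE, CZNE, CZME, CZZE, CZ_starE, CZ_tauE).

(* C(Z)^T and C_T(Z) *)
Definition CZ_invariant : set CZ :=
  [set f : CZ | forall (w : circle R) (z : Z), f (circle_act w z) = f z].
Definition CZ_equivariant : set CZ :=
  [set f : CZ | forall (w : circle R) (z : Z),
    f (circle_act w z) = circle_val w * f z].

End ContinuousFunctions.
Arguments CZ_fun {R Z} f z : simpl never.

Section CrossedProduct.
Variables (R : realType) (Z : TZ2_space R).
Implicit Types f g : CZ Z.

(* (f0, f1) stands for f0 (x) 1 + f1 (x) tau. *)
Definition crossed : Type := (CZ Z * CZ Z)%type.
Implicit Types a b c : crossed.

HB.instance Definition _ := Choice.on crossed.
HB.instance Definition _ := GRing.Lmodule.copy crossed (CZ Z * CZ Z)%type.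

Definition crossed_one : crossed := (1, 0).
Definition crossed_mul a b : crossed :=
  (a.1 * b.1 + a.2 * CZ_tau b.2, a.1 * b.2 + a.2 * CZ_tau b.1).
Definition crossed_star a : crossed := (CZ_star a.1, CZ_tau (CZ_star a.2)).

Lemma crossed_ext a b :
  (forall z, a.1 z = b.1 z) -> (forall z, a.2 z = b.2 z) -> a = b.
Proof. by case: a b => [f g] [h k] /= /CZ_ext-> /CZ_ext->. Qed.

Let fstE (f g : CZ Z) : (f, g).1 = f. Proof. by []. Qed.
Let sndE (f g : CZ Z) : (f, g).2 = g. Proof. by []. Qed.
Let fstD a b : (a + b).1 = a.1 + b.1. Proof. by []. Qed.
Let sndD a b : (a + b).2 = a.2 + b.2. Proof. by []. Qed.
Let pairE := (fstE, sndE, fstD, sndD, CZE, @tauK R Z).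

Lemma crossed_mulA : associative crossed_mul.
Proof.
by move=> a b c; apply: crossed_ext => z; rewrite /crossed_mul !pairE; ring.
Qed.
Lemma crossed_mul1 : left_id crossed_one crossed_mul.
Proof. by move=> a; apply: crossed_ext => z;
  rewrite /crossed_mul ?/crossed_one !pairE; ring. Qed.
Lemma crossed_mulr1 : right_id crossed_one crossed_mul.
Proof. by move=> a; apply: crossed_ext => z;
  rewrite /crossed_mul ?/crossed_one !pairE; ring. Qed.
Lemma crossed_mulDl : left_distributive crossed_mul +%R.
Proof. by move=> a b c; apply: crossed_ext => z;
  rewrite /crossed_mul ?/crossed_one !pairE; ring. Qed.
Lemma crossed_mulDr : right_distributive crossed_mul +%R.
Proof. by move=> a b c; apply: crossed_ext => z;
  rewrite /crossed_mul ?/crossed_one !pairE; ring. Qed.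

HB.instance Definition _ := GRing.Zmodule_isPzRing.Build crossed
  crossed_mulA crossed_mul1 crossed_mulr1 crossed_mulDl crossed_mulDr.

End CrossedProduct.

Lemma sum2 (V : nmodType) (F : 'I_2 -> V) : \sum_i F i = F 0 + F 1.
Proof.
by rewrite !big_ord_recl big_ord0 addr0; congr (_ + F _); apply: val_inj.
Qed.

Lemma ord2 (P : 'I_2 -> Prop) : P 0 -> P 1 -> forall i, P i.
Proof.
move=> P0 P1 [[|[|//]] hi].
  by rewrite (_ : Ordinal _ = 0)//; apply: val_inj.
by rewrite (_ : Ordinal _ = 1)//; apply: val_inj.
Qed.

Section TwoDimensionalHilbertSpace.
Variable R : realType.
Local Notation normc := (@ComplexField.Normc.normc R).
Implicit Types (v w : 'cV[R[i]]_2) (M N : 'M[R[i]]_2).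

Definition l2norm v : R := Num.sqrt (\sum_i normc (v i 0) ^+ 2).

Definition adjoint M : 'M[R[i]]_2 := \matrix_(i, j) (M j i)^*%C.

Let normc_ge0 (x : R[i]) : 0 <= normc x.
Proof. by case: x => x y; exact: sqrtr_ge0. Qed.

Let normcD (x y : R[i]) : normc (x + y) <= normc x + normc y.
Proof. exact: (le_normcD x y). Qed.

Let normcJE (x : R[i]) : normc (x^*%C) = normc x.
Proof. by case: x => x y; rewrite /= sqrrN. Qed.

Let mul_normcJ (x : R[i]) : x * x^*%C = (normc x ^+ 2)%:C.
Proof. by rewrite -sqr_normc rmorphXn. Qed.

Lemma l2norm_ge0 v : 0 <= l2norm v. Proof. exact: sqrtr_ge0. Qed.

Lemma sqr_l2norm v : l2norm v ^+ 2 = \sum_i normc (v i 0) ^+ 2.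
Proof. by rewrite sqr_sqrtr// sumr_ge0// => i _; exact: sqr_ge0. Qed.

Let cauchy2 (a b c d : R) : 0 <= a -> 0 <= b -> 0 <= c -> 0 <= d ->
  a * c + b * d <= Num.sqrt (a ^+ 2 + b ^+ 2) * Num.sqrt (c ^+ 2 + d ^+ 2).
Proof.
move=> a0 b0 c0 d0; rewrite -sqrtrM ?addr_ge0 ?sqr_ge0//.
rewrite -[leLHS]ger0_norm ?addr_ge0 ?mulr_ge0// -sqrtr_sqr; apply: ler_wsqrtr.
by have := sqr_ge0 (a * d - b * c); nra.
Qed.

Lemma l2normD v w : l2norm (v + w) <= l2norm v + l2norm w.
Proof.
rewrite -(@ler_pXn2r _ 2)// ?nnegrE ?addr_ge0 ?l2norm_ge0//.
rewrite sqrrD !sqr_l2norm !sum2 !mxE.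
have h0 := normcD (v 0 0) (w 0 0); have h1 := normcD (v 1 0) (w 1 0).
have := @cauchy2 (normc (v 0 0)) (normc (v 1 0)) (normc (w 0 0)) (normc (w 1 0)).
rewrite !normc_ge0 => /(_ isT isT isT isT).
rewrite /l2norm !sum2.
move: (normc_ge0 (v 0 0 + w 0 0)) (normc_ge0 (v 1 0 + w 1 0)) => p0 p1 cs.
have q0 : normc (v 0 0 + w 0 0) ^+ 2 <= (normc (v 0 0) + normc (w 0 0)) ^+ 2.
  by rewrite ler_pXn2r// nnegrE addr_ge0.
have q1 : normc (v 1 0 + w 1 0) ^+ 2 <= (normc (v 1 0) + normc (w 1 0)) ^+ 2.
  by rewrite ler_pXn2r// nnegrE addr_ge0.
by apply: le_trans (lerD q0 q1) _; rewrite !sqrrD; lra.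
Qed.

Lemma l2normZ (c : R[i]) v : l2norm (c *: v) = normc c * l2norm v.
Proof.
rewrite /l2norm -[normc c]ger0_norm ?normc_ge0// -sqrtr_sqr -sqrtrM ?sqr_ge0//.
congr Num.sqrt; rewrite mulr_sumr; apply: eq_bigr => i _.
by rewrite !mxE ComplexField.Normc.normcM exprMn.
Qed.

Lemma l2norm_eq0 v : l2norm v = 0 -> v = 0.
Proof.
move=> /(congr1 (fun x => x ^+ 2)); rewrite expr0n sqr_l2norm /= => /eqP.
rewrite psumr_eq0 => [/allP h|i _]; last exact: sqr_ge0.
apply/matrixP => i j; rewrite (ord1 j) mxE.
have := h i (mem_index_enum i); rewrite sqrf_eq0 => /eqP.
exact: ComplexField.Normc.eq0_normc.
Qed.

Lemma l2norm0 : l2norm 0 = 0.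
Proof. by rewrite -(scale0r 0) l2normZ ComplexField.Normc.normc0 mul0r. Qed.

Lemma l2norm_entry v i : normc (v i 0) <= l2norm v.
Proof.
rewrite -(@ler_pXn2r _ 2)// ?nnegrE ?l2norm_ge0// sqr_l2norm (bigD1 i)//=.
by rewrite lerDl sumr_ge0// => j _; exact: sqr_ge0.
Qed.

Lemma l2norm_le_sum v : l2norm v <= \sum_i normc (v i 0).
Proof.
rewrite -(@ler_pXn2r _ 2)// ?nnegrE ?l2norm_ge0//; last first.
  by rewrite sumr_ge0.
rewrite sqr_l2norm !sum2 sqrrD.
by have := mulr_ge0 (normc_ge0 (v 0 0)) (normc_ge0 (v 1 0)); lra.
Qed.

Lemma l2norm_mulmx_bound (B : R) M v : (forall i j, normc (M i j) <= B) ->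
  l2norm (M *m v) <= 4 * B * l2norm v.
Proof.
move=> MB; have B0 : 0 <= B := le_trans (normc_ge0 _) (MB 0 0).
have h i : normc ((M *m v) i 0) <= 2 * B * l2norm v.
  rewrite mxE sum2; apply: le_trans (normcD _ _) _.
  have k j : normc (M i j * v j 0) <= B * l2norm v.
    by rewrite ComplexField.Normc.normcM ler_pM// l2norm_entry.
  by have := lerD (k 0) (k 1); lra.
apply: le_trans (l2norm_le_sum _) _; rewrite sum2.
by have := lerD (h 0) (h 1); lra.
Qed.

(* |M v|^2 = <v, M^* M v> <= |v| |M^* M v| *)
Lemma sqr_l2norm_mulmx M v :
  l2norm (M *m v) ^+ 2 <= l2norm v * l2norm (adjoint M *m (M *m v)).
Proof.
set w := M *m v.
have E : (l2norm w ^+ 2)%:C = \sum_j v j 0 * ((adjoint M *m w) j 0)^*%C.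
  rewrite sqr_l2norm rmorph_sum /=.
  under eq_bigr => i _.
    rewrite -mul_normcJ {1}/w mxE mulr_suml.
    over.
  rewrite exchange_big /=; apply: eq_bigr => j _.
  rewrite mxE rmorph_sum mulr_sumr; apply: eq_bigr => i _.
  rewrite !mxE rmorphM /= conjcK; ring.
have -> : l2norm w ^+ 2 = normc ((l2norm w ^+ 2)%:C).
  by rewrite /= expr0n addr0 sqrtr_sqr ger0_norm// sqr_ge0.
rewrite E sum2; apply: le_trans (normcD _ _) _.
rewrite !ComplexField.Normc.normcM !normcJE /l2norm !sum2.
exact: cauchy2.
Qed.

End TwoDimensionalHilbertSpace.

Section CrossedNorm.
Variables (R : realType) (Z : TZ2_space R).
Local Notation normc := (@ComplexField.Normc.normc R).
Implicit Types (a b : crossed Z) (z : Z) (v : 'cV[R[i]]_2).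

(* The regular representation on l^2(Z/2) attached to a point z: f (x) 1 acts
   as diag(f z, f (tau z)), and 1 (x) tau permutes the two basis vectors. *)
Definition regular_rep a z : 'M[R[i]]_2 :=
  \matrix_(i, j) (if i == j then a.1 else a.2) (iter i tau z).

Lemma regular_rep00 a z : regular_rep a z 0 0 = a.1 z.
Proof. by rewrite mxE. Qed.
Lemma regular_rep01 a z : regular_rep a z 0 1 = a.2 z.
Proof. by rewrite mxE. Qed.
Lemma regular_rep10 a z : regular_rep a z 1 0 = a.2 (tau z).
Proof. by rewrite mxE. Qed.
Lemma regular_rep11 a z : regular_rep a z 1 1 = a.1 (tau z).
Proof. by rewrite mxE. Qed.
Definition regular_repE :=
  (regular_rep00, regular_rep01, regular_rep10, regular_rep11).

(* The supremum over z of the operator norms of the regular representations;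
   crossed_cstar_identity below shows that it satisfies the C*-identity. The
   set is empty when Z is, and then sup set0 = 0. *)
Definition crossed_norm a : R :=
  sup [set r | exists z v, l2norm v <= 1 /\ r = l2norm (regular_rep a z *m v)].

Lemma CZ_bounded (f : CZ Z) : exists B : R, forall z, normc (f z) <= B.
Proof.
have normcD (x y : R[i]) : normc (x + y) <= normc x + normc y by exact: le_normcD.
have cts : continuous (fun z => normc (f z)).
  move=> z; apply/cvgrPdist_lt => e e0.
  have e0C : 0 < e%:C :> R[i] by rewrite ltcR.
  have /cvgrPdist_lt /(_ _ e0C) := @CZ_continuous _ _ f z.
  apply: filterS => t; rewrite [X in X < _ -> _](_ : _ = (normc (f z - f t))%:C)//.
  rewrite ltcR => ft; apply: le_lt_trans ft.
  have h1 := normcD (f z - f t) (f t); have h2 := normcD (f t - f z) (f z).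
  rewrite subrK in h2; rewrite -opprB (@normcN R) in h2.
  by rewrite subrK in h1; rewrite ler_norml; lra.
have : bounded_set ((fun z => normc (f z)) @` [set: Z]).
  apply: compact_bounded; apply: continuous_compact; last exact: TZ2_compact.
  exact: continuous_subspaceT.
move=> [M [_ hM]]; exists (M + 1) => z.
apply: le_trans (ler_norm _) _.
by apply: (hM (M + 1)); [rewrite ltrDl | exists z].
Qed.

Lemma regular_rep_bounded a : exists B : R, forall z v,
  l2norm (regular_rep a z *m v) <= B * l2norm v.
Proof.
have [B hB] := CZ_bounded a.1; have [C hC] := CZ_bounded a.2.
exists (4 * Num.max B C) => z v; apply: l2norm_mulmx_bound => i j.
by rewrite mxE le_max; case: eqP => _; rewrite ?hB ?hC ?orbT.
Qed.

Lemma crossed_norm_has_ubound a : has_ubound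
  [set r | exists z v, l2norm v <= 1 /\ r = l2norm (regular_rep a z *m v)].
Proof.
have [B hB] := regular_rep_bounded a; exists (Num.max B 0) => _ [z [v [v1 ->]]].
apply: le_trans (hB z v) _.
apply: (@le_trans _ _ (Num.max B 0 * l2norm v)).
  by rewrite ler_wpM2r ?l2norm_ge0// le_max lexx.
by rewrite ler_piMr// le_max lexx orbT.
Qed.

Lemma regular_rep_le a z v :
  l2norm (regular_rep a z *m v) <= crossed_norm a * l2norm v.
Proof.
have [/l2norm_eq0 ->|v0] := eqVneq (l2norm v) 0.
  by rewrite mulmx0 l2norm0 mulr0.
have vp : 0 < l2norm v by rewrite lt_def v0 l2norm_ge0.
rewrite -ler_pdivrMr//; apply: ub_le_sup; first exact: crossed_norm_has_ubound.
have nc : normc ((l2norm v)^-1)%:C = (l2norm v)^-1.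
  by rewrite /= expr0n addr0 sqrtr_sqr ger0_norm// invr_ge0 ltW.
exists z, (((l2norm v)^-1)%:C *: v); split.
  by rewrite l2normZ nc mulVf.
by rewrite -scalemxAr l2normZ nc mulrC.
Qed.

Lemma crossed_norm_le a (c : R) : 0 <= c ->
  (forall z v, l2norm (regular_rep a z *m v) <= c * l2norm v) ->
  crossed_norm a <= c.
Proof.
move=> c0 h; rewrite /crossed_norm; set A := [set _ | _].
have [->|/set0P A0] := eqVneq A set0; first by rewrite sup0.
apply: ge_sup => // _ [z [v [v1 ->]]].
by apply: le_trans (h z v) _; rewrite ler_piMr.
Qed.

Lemma crossed_norm_ge0 a : 0 <= crossed_norm a.
Proof.
rewrite /crossed_norm; set A := [set _ | _].
have [->|/set0P [x Ax]] := eqVneq A set0; first by rewrite sup0.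
apply: (@le_trans _ _ x); last exact: ub_le_sup (crossed_norm_has_ubound a) _ Ax.
by case: Ax => z [v [_ ->]]; exact: l2norm_ge0.
Qed.

Lemma regular_repD a b z :
  regular_rep (a + b) z = regular_rep a z + regular_rep b z.
Proof. by apply/matrixP => i j; rewrite !mxE; case: eqP. Qed.

Lemma regular_repZ (c : R[i]) a z :
  regular_rep (c *: a) z = c *: regular_rep a z.
Proof. by apply/matrixP => i j; rewrite !mxE; case: eqP. Qed.

Lemma regular_repM a b z :
  regular_rep (a * b) z = regular_rep a z *m regular_rep b z.
Proof.
have E1 : (a * b).1 = a.1 * b.1 + a.2 * CZ_tau b.2 by [].
have E2 : (a * b).2 = a.1 * b.2 + a.2 * CZ_tau b.1 by [].
by apply/matrixP; apply: ord2; apply: ord2;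
  rewrite [RHS]mxE sum2 !regular_repE ?E1 ?E2;
  rewrite !CZE ?tauK // addrC.
Qed.

Lemma regular_rep_star a z :
  regular_rep (crossed_star a) z = adjoint (regular_rep a z).
Proof.
have E1 : (crossed_star a).1 = CZ_star a.1 by [].
have E2 : (crossed_star a).2 = CZ_tau (CZ_star a.2) by [].
by apply/matrixP; apply: ord2; apply: ord2;
  rewrite [RHS]mxE !regular_repE ?E1 ?E2 !CZE ?tauK.
Qed.

Lemma crossed_normD a b : crossed_norm (a + b) <= crossed_norm a + crossed_norm b.
Proof.
apply: crossed_norm_le => [|z v]; first by rewrite addr_ge0 ?crossed_norm_ge0.
rewrite regular_repD mulmxDl mulrDl; apply: le_trans (l2normD _ _) _.
by apply: lerD; exact: regular_rep_le.
Qed.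

Let normc_ge0 (x : R[i]) : 0 <= normc x.
Proof. by case: x => x y; exact: sqrtr_ge0. Qed.

Let crossed_normZ_le (c : R[i]) a :
  crossed_norm (c *: a) <= normc c * crossed_norm a.
Proof.
apply: crossed_norm_le => [|z v]; first by rewrite mulr_ge0 ?crossed_norm_ge0.
rewrite regular_repZ -scalemxAl l2normZ -mulrA ler_wpM2l//.
exact: regular_rep_le.
Qed.

Lemma crossed_normZ (c : R[i]) a :
  crossed_norm (c *: a) = normc c * crossed_norm a.
Proof.
apply/eqP; rewrite eq_le crossed_normZ_le /=.
have [->|c0] := eqVneq c 0.
  by rewrite ComplexField.Normc.normc0 mul0r crossed_norm_ge0.
have nc0 : 0 < normc c.
  rewrite lt_def normc_ge0 andbT; apply: contra c0 => /eqP.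
  by move=> /ComplexField.Normc.eq0_normc ->.
rewrite mulrC -ler_pdivlMr// mulrC -ComplexField.Normc.normcV.
by rewrite -{1}(scale1r a) -(mulVf c0) -scalerA crossed_normZ_le.
Qed.

Lemma crossed_norm_eq0 a : crossed_norm a = 0 -> a = 0.
Proof.
move=> a0.
have rep0 z : regular_rep a z = 0.
  apply/matrixP => i j; have := regular_rep_le a z (delta_mx j 0).
  rewrite a0 mul0r => h.
  have : l2norm (regular_rep a z *m delta_mx j 0) = 0.
    by apply/eqP; rewrite eq_le h l2norm_ge0.
  move=> /l2norm_eq0 /matrixP /(_ i 0).
  by rewrite -colE !mxE.
apply: crossed_ext => z; have /matrixP h := rep0 z.
  by rewrite -regular_rep00 h mxE.
by rewrite -regular_rep01 h mxE.
Qed.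

Lemma crossed_normM a b : crossed_norm (a * b) <= crossed_norm a * crossed_norm b.
Proof.
apply: crossed_norm_le => [|z v]; first by rewrite mulr_ge0 ?crossed_norm_ge0.
rewrite regular_repM -mulmxA; apply: le_trans (regular_rep_le _ _ _) _.
by rewrite -mulrA ler_wpM2l ?crossed_norm_ge0// regular_rep_le.
Qed.

Lemma crossed_starK : involutive (@crossed_star R Z).
Proof.
by move=> a; apply: crossed_ext => z; rewrite /crossed_star /= !CZE ?tauK conjcK.
Qed.

Lemma crossed_cstar_identity a :
  crossed_norm (crossed_star a * a) = crossed_norm a ^+ 2.
Proof.
have le1 b : crossed_norm b ^+ 2 <= crossed_norm (crossed_star b * b).
  have := crossed_norm_ge0 (crossed_star b * b).
  have := regular_rep_le (crossed_star b * b).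
  move: (crossed_norm (crossed_star b * b)) => s hs s0.
  have bs : crossed_norm b <= Num.sqrt s.
    apply: crossed_norm_le => [|z v]; first exact: sqrtr_ge0.
    have x0 := l2norm_ge0 (regular_rep b z *m v).
    have y0 : 0 <= Num.sqrt s * l2norm v.
      by rewrite mulr_ge0 ?sqrtr_ge0 ?l2norm_ge0.
    rewrite -(@ler_pXn2r R 2 _ _ _ x0 y0)// exprMn (sqr_sqrtr s0).
    apply: le_trans (sqr_l2norm_mulmx _ _) _.
    rewrite mulmxA -regular_rep_star -regular_repM mulrC expr2 mulrA.
    by apply: ler_wpM2r; [exact: l2norm_ge0 | exact: hs].
  have b0 := crossed_norm_ge0 b.
  by rewrite -(sqr_sqrtr s0) ler_pXn2r// nnegrE sqrtr_ge0.
have le2 b : crossed_norm b <= crossed_norm (crossed_star b).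
  have := le_trans (le1 b) (crossed_normM _ _).
  have [->|b0] := eqVneq (crossed_norm b) 0; first by rewrite crossed_norm_ge0.
  by rewrite expr2 ler_pM2r// lt_def b0 crossed_norm_ge0.
apply/eqP; rewrite eq_le le1 andbT; apply: le_trans (crossed_normM _ _) _.
rewrite expr2; apply: ler_wpM2r; first exact: crossed_norm_ge0.
by have := le2 (crossed_star a); rewrite crossed_starK.
Qed.

Let Cnorm a : R[i] := (crossed_norm a)%:C.

Let CnormD a b : Cnorm (a + b) <= Cnorm a + Cnorm b.
Proof. by rewrite -rmorphD lecR crossed_normD. Qed.

Let CnormZ (c : R[i]) a : Cnorm (c *: a) = `|c| * Cnorm a.
Proof. by rewrite /Cnorm crossed_normZ rmorphM. Qed.

Let Cnorm_eq0 a : Cnorm a = 0 -> a = 0.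
Proof. by move=> [] /crossed_norm_eq0. Qed.

HB.instance Definition _ :=
  @Lmodule_isNormed.Build R[i] (crossed Z) Cnorm CnormD CnormZ Cnorm_eq0.

Lemma crossed_normE a : `|a| = (crossed_norm a)%:C. Proof. by []. Qed.

End CrossedNorm.

Section RealPoints.
Variables (R : realType) (Z : TZ2_space R).
Implicit Types (a b : crossed Z).

Definition real_points_pred : {pred crossed Z} :=
  [pred a | `[< CZ_invariant a.1 /\ CZ_equivariant a.2 >]].

Lemma real_points_predP a :
  reflect (CZ_invariant a.1 /\ CZ_equivariant a.2) (a \in real_points_pred).
Proof. exact: asboolP. Qed.

Lemma real_points_submod_closed : submod_closed real_points_pred.
Proof.
split; first by apply/real_points_predP; split=> w z; rewrite !CZE ?mulr0.
move=> c a b /real_points_predP [a1 a2] /real_points_predP [b1 b2].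
have E1 : (c *: a + b).1 = c *: a.1 + b.1 by [].
have E2 : (c *: a + b).2 = c *: a.2 + b.2 by [].
apply/real_points_predP; split=> w z; rewrite ?E1 ?E2 !CZE.
  by rewrite a1 b1.
by rewrite a2 b2; ring.
Qed.

Let tau_invariant (f : CZ Z) : CZ_invariant f -> CZ_invariant (CZ_tau f).
Proof. by move=> h w z; rewrite !CZE tau_rot h. Qed.

Let tau_equivariant (f : CZ Z) (w : circle R) (z : Z) : CZ_equivariant f ->
  CZ_tau f (circle_act w z) = (circle_val w)^*%C * CZ_tau f z.
Proof. by move=> h; rewrite !CZE tau_rot h. Qed.

Let circle_mulJ (w : circle R) : circle_val w * (circle_val w)^*%C = 1.
Proof. by rewrite -sqr_normc circle_valE expr1n. Qed.

Lemma real_points_mul_closed : mulr_closed real_points_pred.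
Proof.
split.
  have E1 : (1 : crossed Z).1 = 1 by [].
  have E2 : (1 : crossed Z).2 = 0 by [].
  by apply/real_points_predP; split=> w z; rewrite ?E1 ?E2 !CZE ?mulr0.
move=> a b /real_points_predP [a1 a2] /real_points_predP [b1 b2].
have E1 : (a * b).1 = a.1 * b.1 + a.2 * CZ_tau b.2 by [].
have E2 : (a * b).2 = a.1 * b.2 + a.2 * CZ_tau b.1 by [].
apply/real_points_predP; split=> w z.
  rewrite E1 2!CZDE !CZME a1 b1 a2 (tau_equivariant _ _ b2); congr (_ + _).
  by rewrite mulrACA circle_mulJ mul1r.
by rewrite E2 2!CZDE !CZME a1 b2 a2 (tau_invariant b1); ring.
Qed.

Lemma real_points_star_closed a :
  a \in real_points_pred -> crossed_star a \in real_points_pred.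
Proof.
move=> /real_points_predP [a1 a2].
have E1 : (crossed_star a).1 = CZ_star a.1 by [].
have E2 : (crossed_star a).2 = CZ_tau (CZ_star a.2) by [].
apply/real_points_predP; split=> w z; rewrite ?E1 ?E2 !CZE ?a1//.
by rewrite tau_rot a2 rmorphM /= conjcK.
Qed.

HB.instance Definition _ :=
  GRing.isSubmodClosed.Build R[i] (crossed Z) real_points_pred
    real_points_submod_closed.
HB.instance Definition _ :=
  GRing.isMulClosed.Build (crossed Z) real_points_pred real_points_mul_closed.

(* C(Z_{R,*}) *)
Record real_points_algebra : Type := RealPointsAlgebra {
  real_points_val : crossed Z;
  _ : real_points_val \in real_points_pred }.

HB.instance Definition _ := [isSub for real_points_val].
HB.instance Definition _ := [Choice of real_points_algebra by <:].
HB.instance Definition _ := [SubChoice_isSubZmodule of real_points_algebra by <:].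
HB.instance Definition _ := 
  GRing.SubZmodule_isSubPzRing.Build _ _ real_points_algebra
    (subringClosedP _).
HB.instance Definition _ := [SubZmodule_isSubLmodule of real_points_algebra by <:].

HB.instance Definition _ := Topological.copy real_points_algebra
  (initial_topology real_points_val).

(* Quantum subspaces are encoded by closed two-sided ideals; the whole algebra,
   i.e. the empty subspace, is allowed. *)
Record quantum_subspace : Type := QuantumSubspace {
  qs_ideal : set real_points_algebra;
  qs_closed : closed qs_ideal;
  qs0 : qs_ideal 0;
  qsD : forall f g, qs_ideal f -> qs_ideal g -> qs_ideal (f + g);
  qsZ : forall (c : R[i]) f, qs_ideal f -> qs_ideal (c *: f);
  qsMl : forall f g, qs_ideal g -> qs_ideal (f * g);
  qsMr : forall f g, qs_ideal f -> qs_ideal (f * g)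
}.

Section Quotient.
Variable X : quantum_subspace.

Definition qs_pred : {pred real_points_algebra} :=
  [pred f | f \in qs_ideal X].

Lemma qs_predP f : reflect (qs_ideal X f) (f \in qs_pred).
Proof. by apply: (iffP idP); [move/set_mem | move/mem_set]. Qed.

Lemma qs_zmod_closed : zmod_closed qs_pred.
Proof.
split; first by apply/qs_predP; exact: qs0.
move=> f g /qs_predP hf /qs_predP hg; apply/qs_predP; apply: qsD => //.
by rewrite -scaleN1r; exact: qsZ.
Qed.

HB.instance Definition _ :=
  GRing.isZmodClosed.Build real_points_algebra qs_pred qs_zmod_closed.

(* C(X) *)
Definition qs_algebra : Type := 
  {ideal_quot (qs_pred : zmodClosed real_points_algebra)}.

HB.instance Definition _ := GRing.Zmodule.on qs_algebra.
HB.instance Definition _ := Quotient.on qs_algebra.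

Local Open Scope quotient_scope.

Lemma qs_piP (f g : real_points_algebra) :
  (f = g %[mod qs_algebra]) <-> qs_ideal X (f - g).
Proof.
split=> [/eqP|/qs_predP].
  by rewrite -(Quotient.idealrBE (qs_pred : zmodClosed _)) => /qs_predP.
by rewrite (Quotient.idealrBE (qs_pred : zmodClosed _)) => /eqP.
Qed.

Definition qs_one : qs_algebra := \pi_qs_algebra 1.
Definition qs_mul (x y : qs_algebra) : qs_algebra :=
  \pi_qs_algebra (repr x * repr y).

Lemma qs_piM (f g : real_points_algebra) :
  \pi_qs_algebra (f * g) = qs_mul (\pi f) (\pi g).
Proof.
apply/qs_piP; set f' := repr _; set g' := repr _.
have hf : qs_ideal X (f - f') by apply/qs_piP; rewrite reprK.
have hg : qs_ideal X (g - g') by apply/qs_piP; rewrite reprK.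
have -> : f * g - f' * g' = (f - f') * g + f' * (g - g').
  by rewrite mulrBl mulrBr addrA subrK.
by apply: qsD; [exact: qsMr | exact: qsMl].
Qed.

Lemma qs_piD (f g : real_points_algebra) :
  \pi_qs_algebra (f + g) = \pi_qs_algebra f + \pi_qs_algebra g.
Proof. exact: Quotient.pi_add. Qed.

Lemma qs_mulA : associative qs_mul.
Proof.
move=> x y z; rewrite -[x]reprK -[y]reprK -[z]reprK.
move: (repr x) (repr y) (repr z) => f g h.
by rewrite -(qs_piM g h) -(qs_piM f g) -(qs_piM f) -(qs_piM _ h) mulrA.
Qed.
Lemma qs_mul1 : left_id qs_one qs_mul.
Proof. by move=> x; rewrite -[x]reprK -(qs_piM 1) mul1r. Qed.
Lemma qs_mulr1 : right_id qs_one qs_mul.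
Proof. by move=> x; rewrite -[x]reprK -(qs_piM _ 1) mulr1. Qed.
Lemma qs_mulDl : left_distributive qs_mul +%R.
Proof.
move=> x y z; rewrite -[x]reprK -[y]reprK -[z]reprK.
move: (repr x) (repr y) (repr z) => f g h.
by rewrite -(qs_piD f g) -(qs_piM f h) -(qs_piM g h) -(qs_piM _ h) -qs_piD mulrDl.
Qed.
Lemma qs_mulDr : right_distributive qs_mul +%R.
Proof.
move=> x y z; rewrite -[x]reprK -[y]reprK -[z]reprK.
move: (repr x) (repr y) (repr z) => f g h.
by rewrite -(qs_piD g h) -(qs_piM f g) -(qs_piM f h) -(qs_piM f) -qs_piD mulrDr.
Qed.

HB.instance Definition _ := GRing.Zmodule_isPzRing.Build qs_algebra
  qs_mulA qs_mul1 qs_mulr1 qs_mulDl qs_mulDr.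

Definition non_classical : Prop := ~ commutative ( *%R : qs_algebra -> _).

End Quotient.

Record EF_pair : Type := EFPair {
  EF_E : set Z;
  EF_F : set Z;
  EF_E_reg : EF_E `<=` Z_reg;
  EF_E_stable : forall g z, EF_E z -> EF_E (TZ2_act g z);
  EF_E_closed : EF_E = closure EF_E `&` Z_reg;
  EF_F_real : EF_F `<=` Z_real;
  EF_F_closed : closed EF_F;
  EF_E_F : closure EF_E `&` Z_real `<=` EF_F
}.

End RealPoints.

(* Main.v *)
(** A point z of Z gives the representation
    f |-> ((f0 z, f1 z), (f1 (tau z), f0 (tau z))) of C(Z_{R,*}) on C^2. If z is
    regular, tau z lies off the circle orbit of z and the representation is onto
    the 2x2 matrices; if z = w x with x real, it splits into the two characters
    f |-> f0 y + f1 y at y = x and y = -x. Hence at every point an ideal takes all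
    values compatible with its vanishing locus, and a partition of unity
    consisting of invariant functions turns such pointwise solutions into uniform
    approximations, so a closed ideal is determined by the pair of sets on which
    it vanishes. Conversely a pair (E, F) is recovered from its ideal because
    equivariant functions separate points: a continuous function on an orbit
    extends by Tietze's theorem, and averaging over the circle makes the
    extension equivariant without changing it on the orbit. *)
Require Import Defs.
From mathcomp Require Import all_boot all_order all_algebra.
From mathcomp Require Import all_classical all_reals.
From mathcomp Require Import topology normedtype.
From mathcomp Require Import complex ring lra numfun.
Import Order.TTheory GRing.Theory Num.Theory.
Import numFieldNormedType.Exports.
Set Implicit Arguments.
Unset Strict Implicit.
Unset Printing Implicit Defensive.
Local Open Scope classical_set_scope.
Local Open Scope ring_scope.
Local Open Scope complex_scope.

(* The library's compact_cover needs a pointed space; here near_covering is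
   applied to the filter of all large enough finite index sequences. *)
Lemma compact_finite_cover (T : topologicalType) (I : choiceType) (K : set T)
    (f : I -> set T) :
  compact K -> (forall x, K x -> exists i, nbhs x (f i)) ->
  exists s : seq I, forall x, K x -> exists2 i, i \in s & f i x.
Proof.
move=> /compact_near_coveringP cK cov.
pose G : set_system (seq I) :=
  fun P => exists s0 : seq I, forall s : seq I, {subset s0 <= s} -> P s.
have FG : Filter G.
  split; first by exists [::].
    move=> P Q [s hs] [t ht]; exists (s ++ t) => u hu; split.
      by apply: hs => i si; apply: hu; rewrite mem_cat si.
    by apply: ht => i ti; apply: hu; rewrite mem_cat ti orbT.
  by move=> P Q PQ [s hs]; exists s => t /hs /PQ.
have [x Kx|s0 hs0] := cK _ G (fun s x => exists2 i, i \in s & f i x) FG.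
  have [i fi] := cov x Kx.
  exists (f i, fun s : seq I => is_true (i \in s));
    last by move=> [x' s] [/= ? ?]; exists i.
  by split => //=; exists [:: i] => s; apply; rewrite inE.
by exists s0 => x Kx; apply: hs0 Kx.
Qed.

(** * The circle *)
Section Circle.
Variable R : realType.

Lemma normC_Re (x : R[i]) : `|complex.Re x| <= complex.Re `|x|.
Proof.
case: x => a b /=; rewrite -sqrtr_sqr; apply: ler_wsqrtr.
by rewrite lerDl sqr_ge0.
Qed.

Lemma normC_Im (x : R[i]) : `|complex.Im x| <= complex.Re `|x|.
Proof.
case: x => a b /=; rewrite -sqrtr_sqr; apply: ler_wsqrtr.
by rewrite lerDr sqr_ge0.
Qed.

Lemma normC_le_ReIm (a b : R) : `|a +i* b| <= (`|a| + `|b|)%:C.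
Proof.
rewrite normc_def lecR /= -[leRHS]ger0_norm ?addr_ge0// -sqrtr_sqr.
apply: ler_wsqrtr; rewrite sqrrD !real_normK ?num_real// addrAC lerDl.
by rewrite mulrn_wge0// mulr_ge0.
Qed.

Lemma gt0_complexE (e : R[i]) : 0 < e -> exists2 r : R, 0 < r & e = r%:C.
Proof.
case: e => a b; rewrite ltcE /= => /andP[/eqP -> a0].
by exists a.
Qed.

Lemma complex_continuous (T : topologicalType) (f g : T -> R) :
  continuous f -> continuous g ->
  continuous (fun x => f x +i* g x : Cplx R).
Proof.
move=> cf cg x; apply/cvgrPdist_lt => e /gt0_complexE [r r0 ->].
have r2 : 0 < r / 2 by rewrite divr_gt0.
have /cvgrPdist_lt /(_ _ r2) hf := cf x.
have /cvgrPdist_lt /(_ _ r2) hg := cg x.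
near=> t.
have : `|f x - f t| < r / 2 by near: t.
have : `|g x - g t| < r / 2 by near: t.
move=> h1 h2.
have -> : (f x +i* g x) - (f t +i* g t) = (f x - f t) +i* (g x - g t).
  by simpc.
by apply: le_lt_trans (normC_le_ReIm _ _) _; rewrite ltcR; lra.
Unshelve. all: by end_near. Qed.

Lemma Re_continuous (T : topologicalType) (f : T -> Cplx R) (x : T) :
  {for x, continuous f} -> {for x, continuous (fun t => complex.Re (f t) : R)}.
Proof.
move=> cf; apply/cvgrPdist_lt => e e0.
have e0C : 0 < e%:C :> R[i] by rewrite ltcR.
have /cvgrPdist_lt /(_ _ e0C) := cf.
apply: filterS => t h; rewrite -raddfB; apply: le_lt_trans (normC_Re _) _.
by move: h; rewrite ltcE => /andP[].
Qed.

Lemma Im_continuous (T : topologicalType) (f : T -> Cplx R) (x : T) :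
  {for x, continuous f} -> {for x, continuous (fun t => complex.Im (f t) : R)}.
Proof.
move=> cf; apply/cvgrPdist_lt => e e0.
have e0C : 0 < e%:C :> R[i] by rewrite ltcR.
have /cvgrPdist_lt /(_ _ e0C) := cf.
apply: filterS => t h; rewrite -raddfB; apply: le_lt_trans (normC_Im _) _.
by move: h; rewrite ltcE => /andP[].
Qed.

Lemma normC_continuous (T : topologicalType) (f : T -> R[i]) :
  continuous (f : T -> Cplx R) -> continuous (fun t => `|f t| : Cplx R).
Proof.
move=> cf x; apply/cvgrPdist_lt => e e0.
have /cvgrPdist_lt /(_ _ e0) := cf x.
by apply: filterS => t; apply: le_lt_trans; exact: ler_dist_dist.
Qed.

Lemma cst_continuousC (T : topologicalType) (a : R[i]) :
  continuous (fun _ : T => a : Cplx R).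
Proof. by move=> x; exact: cvg_cst. Qed.

Lemma addC_continuous (T : topologicalType) (f g : T -> R[i]) :
  continuous (f : T -> Cplx R) -> continuous (g : T -> Cplx R) ->
  continuous (fun t => f t + g t : Cplx R).
Proof. by move=> cf cg x; apply: cvgD; [exact: cf | exact: cg]. Qed.

Lemma mulC_continuous (T : topologicalType) (f g : T -> R[i]) :
  continuous (f : T -> Cplx R) -> continuous (g : T -> Cplx R) ->
  continuous (fun t => f t * g t : Cplx R).
Proof. by move=> cf cg x; apply: (@cvgM R[i]); [exact: cf | exact: cg]. Qed.

Lemma invC_continuous (T : topologicalType) (f : T -> R[i]) :
  (forall x, f x != 0) -> continuous (f : T -> Cplx R) ->
  continuous (fun t => (f t)^-1 : Cplx R).
Proof. by move=> f0 cf x; apply: (@cvgV R[i]); [exact: f0 | exact: cf]. Qed.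

Lemma comp_continuous (T U V : topologicalType) (f : T -> U) (g : U -> V) :
  continuous f -> continuous g -> continuous (fun t => g (f t)).
Proof. by move=> cf cg x; apply: continuous_comp; [exact: cf | exact: cg]. Qed.

(** Real and imaginary parts of a unit complex number lie in [-1, 1], so the circle is a closed
    subset of the continuous image of a square. *)
Lemma circle_set_compact : compact (circle_set (R := R)).
Proof.
pose sq := `[(-1 : R), 1]%classic `*` `[(-1 : R), 1]%classic.
pose h (p : R * R) : Cplx R := p.1 +i* p.2.
have ch : continuous h.
  by apply: complex_continuous => p; [exact: cvg_fst | exact: cvg_snd].
have csq : compact sq by apply: compact_setX; exact: segment_compact.
apply: (@subclosed_compact _ _ (h @` sq)).
- have -> : circle_set (R := R) = (fun w : R[i] => `|w| : Cplx R) @^-1` [set 1].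
    by [].
  apply: preimage_closed.
    have hid : continuous (id : Cplx R -> Cplx R) by move=> v; exact: cvg_id.
    by move=> w _; exact: (normC_continuous hid).
  apply: accessible_closed_set1; apply: hausdorff_accessible.
  exact: (@norm_hausdorff R[i] (Cplx R)).
- by apply: continuous_compact => //; exact: continuous_subspaceT.
- move=> [a b] h1; have {}h1 : `|a +i* b| = 1 := h1.
  have := normC_Re (a +i* b); have := normC_Im (a +i* b).
  rewrite h1 /= => hb ha; exists (a, b) => //.
  by split; rewrite /= in_itv /= -ler_norml.
Qed.

Lemma circle_val_continuous : continuous (@circle_val R : circle R -> Cplx R).
Proof. exact: initial_continuous. Qed.

(** Compactness passes to the subtype through near coverings: [P'] quantifies over the circle
    elements above [w], so it makes sense on the ambient plane, and neighbourhoods in the circle are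
    traces of plane ones. *)
Lemma circle_compact : compact [set: circle R].
Proof.
apply/compact_near_coveringP => I F P FF cov.
have /compact_near_coveringP cc := circle_set_compact.
pose P' i (w : Cplx R) := forall v : circle R, circle_val v = w -> P i v.
have : \near F, circle_set (R := R) `<=` P' F.
  apply: cc => w cw; have [[/= U V] [Uw FV] UV] := cov (mk_circle cw) Logic.I.
  have [_ [[A oA <-] Aw] AU] := Uw.
  have nA : nbhs w A by apply: open_nbhs_nbhs; split.
  exists (A, V); first by split.
  move=> [u i] [/= Au Vi] v vu; apply: (UV (v, i)); split => //=.
  by apply: AU; rewrite /preimage /=; move: Au; rewrite -vu.
apply: filterS => i Pi v _; apply: (Pi (circle_val v)) => //.
exact: circle_valE.
Qed.

End Circle.

(** Every lower bound [u m - e m] lies below every upper bound [u n + e n], so the supremum of the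
    lower bounds lies in all the intervals at once. *)
Lemma cauchy_rate_lim (R : realType) (u e : nat -> R) :
  (forall n, 0 <= e n) -> (forall m n, `|u m - u n| <= e m + e n) ->
  exists l, forall n, `|u n - l| <= e n.
Proof.
move=> e0 uC; pose A := [set u m - e m | m in setT].
have ubA n : ubound A (u n + e n).
  by move=> _ [m _ <-]; have := uC m n; rewrite ler_norml; lra.
exists (sup A) => n; rewrite ler_distl; apply/andP; split; last first.
  by rewrite -lerBlDr; apply: ub_le_sup; [exists (u 0 + e 0) | exists n].
rewrite lerBlDr; apply: ge_sup => //; by exists (u 0 - e 0), 0.
Qed.

(** The factor 2 comes from adding the errors of the real and imaginary parts. *)
Lemma cauchy_rate_limC (R : realType) (u : nat -> R[i]) (e : nat -> R) :
  (forall n, 0 <= e n) -> (forall m n, `|u m - u n| <= (e m + e n)%:C) ->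
  exists l, forall n, `|u n - l| <= (e n *+ 2)%:C.
Proof.
move=> e0 uC.
have le_Re (x : R[i]) r : `|x| <= r%:C -> complex.Re `|x| <= r.
  by rewrite lecE => /andP[].
have [a ha] : exists l, forall n, `|complex.Re (u n) - l| <= e n.
  apply: cauchy_rate_lim => // m n.
  by rewrite -raddfB; apply: le_trans (normC_Re _) _; exact: le_Re (uC m n).
have [b hb] : exists l, forall n, `|complex.Im (u n) - l| <= e n.
  apply: cauchy_rate_lim => // m n.
  by rewrite -raddfB; apply: le_trans (normC_Im _) _; exact: le_Re (uC m n).
exists (a +i* b) => n; have := ha n; have := hb n.
case: (u n) => x y /= hy hx.
have -> : (x +i* y) - (a +i* b) = (x - a) +i* (y - b) by simpc.
by apply: le_trans (normC_le_ReIm _ _) _; rewrite lecR mulr2n lerD.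
Qed.

Lemma continuous_pair (T U V : topologicalType) (f : T -> U) (g : T -> V) :
  continuous f -> continuous g -> continuous (fun x => (f x, g x) : U * V).
Proof.
move=> cf cg x.
by apply: (@cvg_pair _ _ _ (nbhs x) (nbhs (f x)) (nbhs (g x)) _ _ _ f g);
  [exact: cf | exact: cg].
Qed.

(** * Continuity of the circle action *)

Section CircleAction.
Variables (R : realType) (Z : TZ2_space R).
Implicit Types (v w : circle R) (z : Z).

Lemma circleC v w : (v * w)%g = (w * v)%g.
Proof. exact: circle_mulC. Qed.

Lemma circle_act1 z : circle_act 1%g z = z.
Proof. exact: TZ2_act1. Qed.

Lemma circle_actM v w z :
  circle_act (v * w)%g z = circle_act v (circle_act w z).
Proof. by rewrite /circle_act -TZ2_actM. Qed.

Lemma circle_act_continuous :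
  continuous (fun p : circle R * Z => circle_act p.1 p.2).
Proof.
have h : continuous (fun p : circle R * Z => (((p.1, false) : TZ2 R), p.2)).
  apply: (@continuous_pair _ (TZ2 R) Z (fun p : circle R * Z => (p.1, false)) snd).
    apply: (@continuous_pair _ (circle R) bool fst (fun=> false)).
      by move=> q; exact: cvg_fst.
    by move=> q; exact: cvg_cst.
  by move=> q; exact: cvg_snd.
exact: (comp_continuous h (@TZ2_act_continuous R Z)).
Qed.

Lemma circle_act_continuousr w : continuous (circle_act w : Z -> Z).
Proof.
have h : continuous (fun z : Z => (w, z)).
  apply: (@continuous_pair _ (circle R) Z (fun=> w) id) => x.
    exact: cvg_cst.
  exact: cvg_id.
exact: (comp_continuous h circle_act_continuous).
Qed.

Lemma circle_act_continuousl z : continuous (fun w => circle_act w z : Z).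
Proof.
have h : continuous (fun w : circle R => (w, z)).
  apply: (@continuous_pair (circle R) (circle R) Z id (fun=> z)) => x.
    exact: cvg_id.
  exact: (@cst_continuous (circle R) Z z x).
exact: (comp_continuous h circle_act_continuous).
Qed.

End CircleAction.

(** * Averaging over the circle *)
Section Averaging.
Variables (R : realType) (Z : TZ2_space R) (c : circle R -> R[i]).
Hypothesis cM : forall v w, c (v * w)%g = c v * c w.
Hypothesis c_norm : forall w, `|c w| = 1.
Hypothesis c_cts : continuous (c : circle R -> Cplx R).
Implicit Types (v w : circle R) (z : Z) (k : Z -> R[i]) (s t : seq (circle R)).

(** The functions fixed by every [twist w] are those that transform by the character [c]. The
    trivial character gives the invariant functions, the inclusion of the circle in the plane the
    equivariant ones. *)
Definition twist w k z : R[i] := (c w)^-1 * k (circle_act w z).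
Definition avg s k z : R[i] := (size s)%:R^-1 * \sum_(w <- s) twist w k z.

Let c_neq0 w : c w != 0.
Proof. by rewrite -normr_eq0 c_norm oner_neq0. Qed.

Let c1 : c 1%g = 1.
Proof. by apply: (mulfI (c_neq0 1%g)); rewrite -cM mulg1 mulr1. Qed.

Lemma twistM v w k : twist v (twist w k) = twist (v * w)%g k.
Proof.
apply/funext => z; rewrite /twist -circle_actM cM invfM mulrA.
by rewrite (circleC w v).
Qed.

Lemma norm_twist w k z : `|twist w k z| = `|k (circle_act w z)|.
Proof. by rewrite /twist normrM normfV c_norm invr1 mul1r. Qed.

Lemma twist_avg s w k : twist w (avg s k) = avg s (twist w k).
Proof.
apply/funext => z; rewrite /avg {1}/twist mulrCA mulr_sumr.
congr (_ * _); apply: eq_bigr => v _; rewrite /twist -!circle_actM.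
by rewrite mulrCA (circleC w v).
Qed.

Lemma avg_avg s t k : avg s (avg t k) = avg [seq (v * w)%g | v <- s, w <- t] k.
Proof.
apply/funext => z; rewrite /avg big_allpairs_dep size_allpairs natrM invfM -mulrA.
congr (_ * _); rewrite mulr_sumr; apply: eq_bigr => v _.
by rewrite /twist mulrCA mulr_sumr; congr (_ * _); apply: eq_bigr => w _;
  rewrite circleC cM circle_actM invfM mulrA [X in X * _ = _]mulrC.
Qed.

(** Commutativity of the circle enters here; it serves to treat several group elements at once and
    to compare two averages in the Cauchy estimate. *)
Lemma avgC s t k : avg s (avg t k) = avg t (avg s k).
Proof.
apply/funext => z; rewrite !avg_avg /avg !big_allpairs_dep !size_allpairs mulnC.
congr (_ * _); rewrite exchange_big; apply: eq_bigr => w _.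
by apply: eq_bigr => v _; rewrite (circleC v w).
Qed.

Let sumr_const_seq (T : Type) (r : seq T) (x : R[i]) :
  \sum_(i <- r) x = x *+ size r.
Proof. by rewrite big_const_seq count_predT iter_addr_0. Qed.

Lemma avgB s k l z : avg s k z - avg s l z = avg s (k \- l) z.
Proof.
rewrite /avg -mulrBr -sumrB; congr (_ * _); apply: eq_bigr => w _.
by rewrite /twist /= mulrBr.
Qed.

Let norm_mean (T : Type) (r : seq T) (F : T -> R[i]) (e : R[i]) :
  (0 < size r)%N -> (forall i, `|F i| <= e) ->
  `|(size r)%:R^-1 * \sum_(i <- r) F i| <= e.
Proof.
move=> r0 h; rewrite normrM normfV normr_nat mulrC ler_pdivrMr ?ltr0n//.
apply: le_trans (ler_norm_sum _ _ _) _.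
by rewrite mulr_natr -sumr_const_seq; apply: ler_sum.
Qed.

Lemma norm_avg s k z (e : R[i]) : s != [::] ->
  (forall w, `|twist w k z| <= e) -> `|avg s k z| <= e.
Proof. by rewrite -size_eq0 -lt0n => s0 h; exact: norm_mean. Qed.

Lemma norm_avgB s k z (e : R[i]) : s != [::] ->
  (forall w, `|twist w k z - k z| <= e) -> `|avg s k z - k z| <= e.
Proof.
rewrite -size_eq0 => s0 h.
have -> : avg s k z - k z = (size s)%:R^-1 * \sum_(w <- s) (twist w k z - k z).
  by rewrite sumrB sumr_const_seq mulrBr -[k z *+ _]mulr_natl mulKf// pnatr_eq0.
by apply: norm_mean => //; rewrite lt0n.
Qed.

(* Telescoping: averaging over 1, w, ..., w^(N-1) makes a bounded function
   equivariant under w up to O(1/N). *)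
Lemma avg_powers (w : circle R) (B e : R) : 0 < e ->
  exists2 t, t != [::] & forall k, (forall z, `|k z| <= B%:C) ->
    forall z, `|twist w (avg t k) z - avg t k z| <= e%:C.
Proof.
(* Telescoping leaves two boundary terms of norm at most [B], divided by the number [N.+1] of
   powers. *)
move=> e0; have [N hN] : exists N : nat, (B *+ 2) / e < N.+1%:R.
  exists (Num.truncn ((B *+ 2) / e)); exact: Num.Theory.truncnS_gt.
exists [seq (w ^+ i)%g | i <- iota 0 N.+1] => // k kB z.
have -> : twist w (avg [seq (w ^+ i)%g | i <- iota 0 N.+1] k) z
    - avg [seq (w ^+ i)%g | i <- iota 0 N.+1] k z
    = N.+1%:R^-1 * (twist (w ^+ N.+1)%g k z - k z).
  rewrite twist_avg /avg size_map size_iota -mulrBr -sumrB big_map; congr (_ * _).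
  under eq_bigr => i _ do rewrite twistM circleC.
  rewrite -[iota _ _]/(index_iota 0 N.+1).
  rewrite (@telescope_sumr_eq _ _ _ (fun i => twist (w ^+ i)%g k z))//.
    by rewrite expg0 /twist c1 invr1 mul1r circle_act1.
  by move=> i _; rewrite expgS.
rewrite normrM normfV normr_nat mulrC ler_pdivrMr ?ltr0n//.
apply: le_trans (ler_normB _ _) _; rewrite norm_twist.
apply: le_trans (lerD (kB _) (kB _)) _.
have -> : N.+1%:R = (N.+1%:R : R)%:C by rewrite rmorph_nat.
rewrite -rmorphD -rmorphM lecR -mulr2n mulrC.
by move: hN; rewrite ltr_pdivrMr// => /ltW.
Qed.

Let size_allpairs_neq0 s t : s != [::] -> t != [::] ->
  [seq (v * w)%g | v <- s, w <- t] != [::].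
Proof. by rewrite -!size_eq0 size_allpairs muln_eq0 => /negbTE-> /negbTE->. Qed.

(** One average is composed for each element of [ws]. As averages commute and do not increase the
    sup norm, a further one does not spoil the estimates already obtained. *)
Lemma avg_seq (ws : seq (circle R)) (B e : R) : 0 < e ->
  exists2 t, t != [::] & forall k, (forall z, `|k z| <= B%:C) ->
    forall w, w \in ws -> forall z, `|twist w (avg t k) z - avg t k z| <= e%:C.
Proof.
move=> e0; elim: ws => [|w ws [s s0 hs]]; first by exists [:: 1%g].
have [t t0 ht] := avg_powers w B e0.
exists [seq (v * w)%g | v <- s, w <- t]; first exact: size_allpairs_neq0.
move=> k kB v; rewrite inE -avg_avg => /orP[/eqP ->|vws] z.
  rewrite twist_avg avgB; apply: norm_avg => // u.
  by rewrite norm_twist; apply: ht.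
rewrite avgC twist_avg avgB; apply: norm_avg => // u.
by rewrite norm_twist; apply: hs.
Qed.

Lemma twist_continuous k : continuous (k : Z -> Cplx R) ->
  continuous (fun p : circle R * Z => twist p.1 k p.2 : Cplx R).
Proof.
move=> ck.
have c1p : continuous (fun p : circle R * Z => c p.1 : Cplx R).
  by apply: (comp_continuous (f := fst) _ c_cts) => p; exact: cvg_fst.
exact: (mulC_continuous (invC_continuous (fun p => c_neq0 p.1) c1p)
  (comp_continuous (@circle_act_continuous R Z) ck)).
Qed.

Lemma twist_continuousr w k : continuous (k : Z -> Cplx R) ->
  continuous (twist w k : Z -> Cplx R).
Proof.
move=> ck; exact: (mulC_continuous (@cst_continuousC R Z (c w)^-1)
  (comp_continuous (@circle_act_continuousr R Z w) ck)).
Qed.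

(** The map sending [w] to [twist w k] is continuous for the sup norm because [Z] is compact, and
    the circle is compact, so a finite net of twists exists. *)
Lemma twist_totally_bounded k (e : R) : continuous (k : Z -> Cplx R) -> 0 < e ->
  exists ws : seq (circle R), forall w, exists2 v, v \in ws &
    forall z, `|twist w k z - twist v k z| <= e%:C.
Proof.
move=> ck e0.
pose f v := [set w | forall z, `|twist w k z - twist v k z| <= e%:C].
have e2 : 0 < (e / 2)%:C :> R[i] by rewrite ltcR divr_gt0.
have [||ws hws] := @compact_finite_cover _ (circle R) setT f.
- exact: circle_compact.
- move=> w _; exists w.
  have /compact_near_coveringP cZ := @TZ2_compact _ Z.
  (* Compactness of [Z] turns joint continuity at each point (w, z) into one neighbourhood of [w]
     that serves all [z]. *)
  have := cZ _ (nbhs w) (fun v z => `|twist v k z - twist w k z| <= e%:C) _.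
  have hnear z : [set: Z] z -> \forall z' \near z & v \near nbhs w,
      `|twist v k z' - twist w k z'| <= e%:C.
    move=> _; have /cvgrPdist_lt /(_ _ e2) := @twist_continuous k ck (w, z).
    case=> -[U V] /= [Uw Vz] UV.
    exists (V, U) => // -[z' v] [/= Vz' Uv].
    have /= h1 := UV (v, z') (conj Uv Vz').
    have /= h2 := UV (w, z') (conj (nbhs_singleton Uw) Vz').
    apply: le_trans (ler_distD (twist w k z) _ _) _.
    rewrite distrC [e]splitr rmorphD /=; apply: lerD; exact: ltW.
  by move=> /(_ _ hnear); apply: filterS => v hv z; exact: hv.
- exists ws => w; have [v vws vw] := hws w Logic.I; by exists v.
Qed.

(** Half of the error is spent on replacing [w] by a nearby element of the finite net, half on near
    equivariance under that net. *)
Lemma avg_approx k (B e : R) : continuous (k : Z -> Cplx R) ->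
  (forall z, `|k z| <= B%:C) -> 0 < e ->
  exists2 s, s != [::] &
    forall w z, `|twist w (avg s k) z - avg s k z| <= e%:C.
Proof.
move=> ck kB e0; have e2 : 0 < e / 2 by rewrite divr_gt0.
have [ws hws] := twist_totally_bounded ck e2.
have [s s0 hs] := avg_seq ws B e2; exists s => // w z.
have [v vws wv] := hws w.
apply: le_trans (ler_distD (twist v (avg s k) z) _ _) _.
rewrite [e]splitr rmorphD /=; apply: lerD; last exact: hs.
rewrite !twist_avg avgB; apply: norm_avg => // u.
by rewrite norm_twist; exact: wv.
Qed.

Lemma avg_continuous s k : continuous (k : Z -> Cplx R) ->
  continuous (avg s k : Z -> Cplx R).
Proof.
move=> ck.
have cs : continuous (fun z => \sum_(w <- s) twist w k z : Cplx R).
  elim: s => [|w s IH].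
    rewrite (_ : (fun z => _) = (fun=> 0)); first exact: (@cst_continuousC R Z 0).
    by apply/funext => z; rewrite big_nil.
  rewrite (_ : (fun z => _) =
      (fun z => twist w k z + \sum_(v <- s) twist v k z)); last first.
    by apply/funext => z; rewrite big_cons.
  exact: (addC_continuous (twist_continuousr (w := w) ck) IH).
exact: (mulC_continuous (@cst_continuousC R Z (size s)%:R^-1) cs).
Qed.

(* Von Neumann's construction of the mean: finite averages of k over the circle
   are equivariant up to an error tending to 0, and as averages commute they
   form a Cauchy sequence. *)
Lemma equivariant_projection (k : CZ Z) : exists2 g : CZ Z,
  forall w z, g (circle_act w z) = c w * g z &
  forall z, (forall w, k (circle_act w z) = c w * k z) -> g z = k z.
Proof.
have [B hB] := CZ_bounded k.
have kB z : `|k z| <= B%:C by rewrite lecR; exact: hB.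
pose e n : R := n.+1%:R^-1.
have e0 n : 0 < e n by rewrite invr_gt0 ltr0n.
have /choice [s hs] : forall n, exists s, s != [::] /\
    forall w z, `|twist w (avg s k) z - avg s k z| <= (e n)%:C.
  by move=> n; have [s s0 hs] := avg_approx (@CZ_continuous _ _ k) kB (e0 n);
    exists s.
pose u n := avg (s n) k.
have s0 n : s n != [::] by have [] := hs n.
have ue n w z : `|twist w (u n) z - u n z| <= (e n)%:C by have [] := hs n.
have uC m n z : `|u m z - u n z| <= (e m + e n)%:C.
  (* Averaging the almost equivariant [u m] over [s n] moves it by at most [e m]; by [avgC] the
     result is also the average of [u n] over [s m], which is within [e n] of [u n]. *)
  apply: le_trans (ler_distD (avg (s n) (u m) z) _ _) _.
  rewrite rmorphD /=; apply: lerD.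
    by rewrite distrC; apply: norm_avgB => // w.
  by rewrite /u avgC; apply: norm_avgB => // w; exact: ue.
have /choice [g hg] : forall z, exists l, forall n, `|u n z - l| <= (e n *+ 2)%:C.
  by move=> z; apply: cauchy_rate_limC => // n; exact: ltW.
have small (x : R[i]) (C : nat) : (forall n, `|x| <= (e n *+ C)%:C) -> x = 0.
  move=> hx; apply/eqP; rewrite -normr_eq0; apply/eqP; apply: le_anti.
  rewrite normr_ge0 andbT; apply/ler_addgt0Pr => r /gt0_complexE [d d0 ->].
  rewrite add0r; pose N := Num.truncn (C%:R / d).
  apply: le_trans (hx N) _; rewrite lecR -mulr_natr mulrC ler_pdivrMr ?ltr0n//.
  by rewrite mulrC -ler_pdivrMr//; apply/ltW/Num.Theory.truncnS_gt.
have cg : continuous (g : Z -> Cplx R).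
  move=> z; apply/cvgrPdist_lt => r /gt0_complexE [d d0 ->].
  (* The uniform error [e N *+ 2] has to be below [d / 3]: it occurs at two points, and the
     variation of [u N] takes the remaining third. *)
  pose N := Num.truncn (6 / d).
  have eN : e N *+ 2 < d / 3.
    rewrite -[e N *+ 2]mulr_natl ltr_pdivrMr ?ltr0n// mulrC -ltr_pdivrMr ?divr_gt0//.
    rewrite invf_div mulrA -natrM; exact: Num.Theory.truncnS_gt.
  have d3 : 0 < (d / 3)%:C :> R[i] by rewrite ltcR divr_gt0.
  have /cvgrPdist_lt /(_ _ d3) := @avg_continuous (s N) k (@CZ_continuous _ _ k) z.
  apply: filterS => t ht.
  have h1 := hg z N; have h2 := hg t N; rewrite distrC in h1.
  apply: le_lt_trans (ler_distD (u N z) _ _) _.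
  have -> : d = d / 3 + (d / 3 + d / 3) by lra.
  rewrite rmorphD /=; apply: ltr_leD; first by apply: le_lt_trans h1 _; rewrite ltcR.
  apply: le_trans (ler_distD (u N t) _ _) _.
  rewrite rmorphD /=; apply: lerD; first exact: ltW.
  by apply: le_trans h2 _; rewrite lecR ltW.
exists (mk_CZ cg) => [w z|z hz].
  (* Five errors [e n]: two for replacing [g] by [u n] at [y], two at [z], and one for the near
     equivariance of [u n]. *)
  apply/eqP; rewrite -subr_eq0; apply/eqP; apply: (small _ 5) => n.
  pose y := circle_act w z.
  have -> : g y - c w * g z
      = (g y - u n y) + (u n y - c w * u n z + c w * (u n z - g z)) by ring.
  have h1 := hg y n; have h2 := hg z n; rewrite distrC in h1.
  apply: le_trans (ler_normD _ _) _; rewrite (mulrnDr _ 2 3) rmorphD /=.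
  apply: lerD => //; apply: le_trans (ler_normD _ _) _.
  rewrite (mulrnDr _ 1 2) rmorphD /=.
  apply: lerD; last by rewrite normrM c_norm mul1r.
  have -> : u n y - c w * u n z = c w * (twist w (u n) z - u n z).
    by rewrite /twist -/y mulrBr mulVKf.
  by rewrite normrM c_norm mul1r.
apply/eqP; rewrite -subr_eq0; apply/eqP; apply: (small _ 2) => n.
rewrite distrC; apply: le_trans (hg z n).
(* Where [k] already transforms by [c] along the orbit, all its twists at [z] equal [k z], so each
   average is exact. *)
suff -> : u n z = k z by [].
rewrite /u /avg; under eq_bigr => w _ do rewrite /twist hz mulKf//.
by rewrite sumr_const_seq -[k z *+ _]mulr_natl mulKf// pnatr_eq0 size_eq0.
Qed.

End Averaging.

Lemma circle_sqrt (R : realType) (w : circle R) : exists u, (u * u)%g = w.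
Proof.
have h : `|sqrtC (circle_val w)| = 1.
  apply/eqP; rewrite -(@pexpr_eq1 _ _ 2)//; apply/eqP.
  by rewrite -normrX sqrtCK circle_valE.
exists (mk_circle h); apply: circle_val_inj.
by rewrite -[RHS]sqrtCK expr2.
Qed.

(** * Separating points by equivariant functions *)
Section Separation.
Variables (R : realType) (Z : TZ2_space R).
Implicit Types (v w : circle R) (y z : Z) (C : set Z).

Lemma invariant_projection (k : CZ Z) : exists2 g : CZ Z, CZ_invariant g &
  forall z, (forall w, k (circle_act w z) = k z) -> g z = k z.
Proof.
have [|||g hg kg] := @equivariant_projection R Z (fun=> 1) _ _ _ k.
- by move=> v w; rewrite mulr1.
- by move=> w; rewrite normr1.
- exact: (@cst_continuousC R (circle R) 1).
exists g => [w z|z hz]; first by rewrite hg mul1r.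
by apply: kg => w; rewrite hz mul1r.
Qed.

Lemma orbit_closed (K : set (circle R)) z : closed K ->
  closed [set circle_act w z | w in K].
Proof.
move=> cK; apply: compact_closed; first exact: TZ2_hausdorff.
apply: continuous_compact.
  by apply: continuous_subspaceT; exact: circle_act_continuousl.
by apply: (subclosed_compact cK); first exact: circle_compact.
Qed.

Lemma saturation_closed C : closed C ->
  closed [set z | exists w, C (circle_act w z)].
Proof.
move=> cC.
have -> : [set z | exists w, C (circle_act w z)] =
    (fun p : circle R * Z => circle_act p.1 p.2) @` ([set: circle R] `*` C).
  apply/seteqP; split=> [z [w Cwz]|_ [[w z] [_ /= Cz] <-]].
    exists ((w^-1)%g, circle_act w z) => //=.
    by rewrite -circle_actM mulVg circle_act1.
  by exists (w^-1)%g; rewrite -circle_actM mulVg circle_act1.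
apply: compact_closed; first exact: TZ2_hausdorff.
apply: continuous_compact.
  by apply: continuous_subspaceT; exact: circle_act_continuous.
apply: compact_setX; first exact: circle_compact.
by apply: (subclosed_compact cC); first exact: TZ2_compact.
Qed.

Lemma TZ2_space_normal : normal_space Z.
Proof. by apply: compact_normal; [exact: TZ2_hausdorff | exact: TZ2_compact]. Qed.

(** Urysohn's lemma separates the orbit of [x] from the saturation of [C]. The resulting function is
    constant on each orbit inside these two sets, so averaging keeps its values there. *)
Lemma invariant_urysohn C x : closed C -> (forall w, ~ C (circle_act w x)) ->
  exists f : CZ Z, [/\ CZ_invariant f, f x = 1 & forall z, C z -> f z = 0].
Proof.
move=> cC Cx; pose A := [set circle_act w x | w in [set: circle R]].
have cA : closed A by apply: orbit_closed; exact: closedT.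
have [|f [cf fA fC _]] :=
  urysohn_ext_itv TZ2_space_normal (saturation_closed cC) cA _ (@ltr01 R).
  apply/seteqP; split=> // y [[w Cw] [v _ vx]]; apply: (Cx (w * v)%g).
  by rewrite /= circle_actM vx.
have cf' : continuous (fun z => f z +i* 0 : Cplx R).
  by apply: complex_continuous => // z; exact: cvg_cst.
have kE z : mk_CZ cf' z = f z +i* 0 by [].
have [g gi gk] := invariant_projection (mk_CZ cf').
exists g; split=> // [|z Cz].
  have fAE w : f (circle_act w x) = 1.
    by apply: fC; exists (circle_act w x) => //; exists w.
  have := fAE 1%g; rewrite circle_act1 => fx.
  by rewrite gk => [|w]; rewrite !kE ?fAE fx.
have fCE w : f (circle_act w z) = 0.
  apply: fA; exists (circle_act w z) => //; exists (w^-1)%g.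
  by rewrite -circle_actM mulVg circle_act1.
have := fCE 1%g; rewrite circle_act1 => fz.
by rewrite gk => [|w]; rewrite !kE ?fCE fz.
Qed.

Hypothesis Zfree : free_circle_action Z.

(** Freeness makes the orbit a copy of the circle; the inverse [r] of the orbit map is the
    equivariant function to be extended from it. *)
Lemma equivariant_section z :
  exists2 f : CZ Z, CZ_equivariant f & f z = 1.
Proof.
pose A := [set circle_act w z | w in [set: circle R]].
have cA : closed A by apply: orbit_closed; exact: closedT.
have /choice [r hr] : forall y, exists w, A y -> circle_act w z = y.
  move=> y; have [[w _ <-]|nA] := pselect (A y); first by exists w.
  by exists 1%g => /nA.
have rE w : r (circle_act w z) = w.
  have := hr (circle_act w z) (ex_intro2 _ _ w Logic.I erefl).
  set u := r _ => uw; have : circle_act (w^-1 * u)%g z = z.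
    by rewrite circle_actM uw -circle_actM mulVg circle_act1.
  by move=> /Zfree /(congr1 (fun v => w * v)%g); rewrite mulgA mulgV mul1g mulg1.
(* r inverts the orbit map, which is closed since the circle is compact. *)
have cr : continuous (r : subspace A -> circle R).
  apply/continuous_closedP => K cK; rewrite closed_subspaceP.
  exists [set circle_act w z | w in K]; first exact: (@orbit_closed K z cK).
  apply/seteqP; split=> y [] /=.
    by move=> [w Kw <-] Aw; rewrite rE.
  by move=> Kr Ay; split=> //; exists (r y) => //; exact: hr.
(* Tietze's theorem extends bounded real functions, so the real and imaginary parts are extended
   separately. *)
have ext (p : circle R -> R) : continuous p -> (forall w, `|p w| <= 1) ->
    exists2 g : Z -> R, continuous g & forall w, g (circle_act w z) = p w.
  move=> cp p1.
  have cpr : {within A, continuous (p \o r)} := comp_continuous cr cp.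
  have [|g [gE cg _]] := continuous_bounded_extension TZ2_space_normal cA ltr01 cpr.
    by move=> y _; exact: p1.
  exists g => // w; rewrite -gE ?inE /= ?rE//; by exists w.
have cv := @circle_val_continuous R.
have [||g1 cg1 g1E] := ext (fun w => complex.Re (circle_val w)).
- by move=> w; apply: (@Re_continuous R (circle R) _ w); exact: cv.
- by move=> w; apply: le_trans (normC_Re _) _; rewrite circle_valE.
have [||g2 cg2 g2E] := ext (fun w => complex.Im (circle_val w)).
- by move=> w; apply: (@Im_continuous R (circle R) _ w); exact: cv.
- by move=> w; apply: le_trans (normC_Im _) _; rewrite circle_valE.
pose k := mk_CZ (complex_continuous cg1 cg2).
have kE w : k (circle_act w z) = circle_val w.
  rewrite /k -[LHS]/(g1 (circle_act w z) +i* g2 (circle_act w z)) g1E g2E.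
  by case: (circle_val w).
have kz : k z = 1 by rewrite -[z]circle_act1 kE.
have [||f fe fk] := @equivariant_projection R Z (@circle_val R) _ _ cv k.
- by [].
- exact: circle_valE.
by exists f => //; rewrite fk => [|w]; rewrite ?kE kz ?mulr1.
Qed.

(** If tau z = w z and u is a square root of w, then tau (u z) = conj(u) w z = u z, so [z] would be
    a rotation of the real point u z. *)
Lemma Z_reg_orbit z w : Z_reg z -> circle_act w z <> tau z.
Proof.
move=> zr wz; have [u uu] := circle_sqrt w.
apply: zr; exists (u^-1)%g, (circle_act u z); split; last first.
  by rewrite -circle_actM mulVg circle_act1.
rewrite /Z_real /= tau_rot -wz -circle_actM -uu; congr circle_act.
by rewrite mulgA (_ : (circle_conj u * u)%g = 1%g) ?mul1g; last exact: circle_mulV.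
Qed.

(** An equivariant function equal to 1 at [z] is multiplied by an invariant one that vanishes at
    [tau z], a point off the orbit of [z]. *)
Lemma equivariant_separation z : Z_reg z ->
  exists f : CZ Z, [/\ CZ_equivariant f, f z = 1 & f (tau z) = 0].
Proof.
move=> zr; have [f fe fz] := equivariant_section z.
have [||g [gi gz gt]] := @invariant_urysohn [set tau z] z.
- apply: accessible_closed_set1; apply: hausdorff_accessible.
  exact: TZ2_hausdorff.
- by move=> w; exact: Z_reg_orbit.
exists (f * g); split.
- by move=> w y; rewrite !CZE fe gi mulrA.
- by rewrite CZE fz gz mulr1.
- by rewrite CZE gt ?mulr0.
Qed.

End Separation.

(** * Even and odd parts *)
Section Parts.
Variables (R : realType) (Z : TZ2_space R).
Local Notation A := (real_points_algebra Z).
Local Notation normc := (@ComplexField.Normc.normc R).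
Implicit Types (f g a b : A) (z : Z) (w : circle R).

Definition even_part f : CZ Z := (real_points_val f).1.
Definition odd_part f : CZ Z := (real_points_val f).2.
Definition rep f z : 'M[R[i]]_2 := regular_rep (real_points_val f) z.

Lemma even_part_invariant f : CZ_invariant (even_part f).
Proof. by case: f => x xP; have /real_points_predP [] := xP. Qed.

Lemma odd_part_equivariant f : CZ_equivariant (odd_part f).
Proof. by case: f => x xP; have /real_points_predP [] := xP. Qed.

Lemma even_partD f g z : even_part (f + g) z = even_part f z + even_part g z.
Proof. by []. Qed.
Lemma odd_partD f g z : odd_part (f + g) z = odd_part f z + odd_part g z.
Proof. by []. Qed.
Lemma even_part0 z : even_part 0 z = 0. Proof. by []. Qed.
Lemma odd_part0 z : odd_part 0 z = 0. Proof. by []. Qed.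
Lemma even_partN f z : even_part (- f) z = - even_part f z.
Proof. by []. Qed.
Lemma odd_partN f z : odd_part (- f) z = - odd_part f z.
Proof. by []. Qed.
Lemma even_partZ (c : R[i]) f z : even_part (c *: f) z = c * even_part f z.
Proof. by []. Qed.
Lemma odd_partZ (c : R[i]) f z : odd_part (c *: f) z = c * odd_part f z.
Proof. by []. Qed.
Lemma even_partM f g z :
  even_part (f * g) z =
  even_part f z * even_part g z + odd_part f z * odd_part g (tau z).
Proof. by []. Qed.
Lemma odd_partM f g z :
  odd_part (f * g) z =
  even_part f z * odd_part g z + odd_part f z * even_part g (tau z).
Proof. by []. Qed.

Definition partE := (even_partD, odd_partD, even_part0, odd_part0,
  even_partN, odd_partN,
  even_partZ, odd_partZ, even_partM, odd_partM).

Lemma even_part_sum (I : Type) (s : seq I) (F : I -> A) z :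
  even_part (\sum_(i <- s) F i) z = \sum_(i <- s) even_part (F i) z.
Proof.
exact: (big_morph (fun f => even_part f z) (fun f g => even_partD f g z)).
Qed.

Lemma odd_part_sum (I : Type) (s : seq I) (F : I -> A) z :
  odd_part (\sum_(i <- s) F i) z = \sum_(i <- s) odd_part (F i) z.
Proof.
exact: (big_morph (fun f => odd_part f z) (fun f g => odd_partD f g z)).
Qed.

Lemma repE f z : (rep f z 0 0 = even_part f z) * (rep f z 0 1 = odd_part f z) *
  (rep f z 1 0 = odd_part f (tau z)) * (rep f z 1 1 = even_part f (tau z)).
Proof. by rewrite /rep !regular_repE. Qed.

Lemma repD f g z : rep (f + g) z = rep f z + rep g z.
Proof. exact: regular_repD. Qed.

Lemma repM f g z : rep (f * g) z = rep f z *m rep g z.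
Proof. exact: regular_repM. Qed.

Lemma repZ (c : R[i]) f z : rep (c *: f) z = c *: rep f z.
Proof. exact: regular_repZ. Qed.

Lemma rep0 z : rep 0 z = 0.
Proof. by apply/matrixP => i j; rewrite !mxE; case: eqP. Qed.

Lemma rep_eqP f g z : rep f z = rep g z <->
  [/\ even_part f z = even_part g z, odd_part f z = odd_part g z,
      even_part f (tau z) = even_part g (tau z) &
      odd_part f (tau z) = odd_part g (tau z)].
Proof.
split=> [/matrixP h|[h1 h2 h3 h4]].
  have h00 := h 0 0; have h01 := h 0 1; have h10 := h 1 0; have h11 := h 1 1.
  by rewrite !repE in h00 h01 h10 h11.
by apply/matrixP; apply: ord2; apply: ord2; rewrite !repE.
Qed.

Definition mk_real_points (h k : CZ Z) (hi : CZ_invariant h)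
    (ke : CZ_equivariant k) : A :=
  RealPointsAlgebra (introT (real_points_predP (h, k)) (conj hi ke)).

Lemma CZ_invariant0 : CZ_invariant (0 : CZ Z). Proof. by []. Qed.

Lemma CZ_equivariant0 : CZ_equivariant (0 : CZ Z).
Proof. by move=> w z; rewrite !CZE mulr0. Qed.

Definition mk_even (h : CZ Z) (hi : CZ_invariant h) : A :=
  mk_real_points hi CZ_equivariant0.
Definition mk_odd (h : CZ Z) (he : CZ_equivariant h) : A :=
  mk_real_points CZ_invariant0 he.

(** An entry is a coordinate of the image of a unit basis vector. *)
Lemma norm_rep_le f z i j : normc (rep f z i j) <= crossed_norm (real_points_val f).
Proof.
have := regular_rep_le (real_points_val f) z (delta_mx j 0).
have -> : l2norm (delta_mx j 0 : 'cV[R[i]]_2) = 1.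
  rewrite /l2norm (bigD1 j)// big1 => [|k kj].
    by rewrite mxE !eqxx ComplexField.Normc.normc1 expr1n /= addr0 sqrtr1.
  by rewrite mxE (negbTE kj) ComplexField.Normc.normc0 expr0n.
rewrite mulr1 -colE; apply: le_trans.
by have := l2norm_entry (col j (rep f z)) i; rewrite mxE.
Qed.

Lemma nbhs_real_pointsP (a : A) (B : set A) : nbhs a B <->
  exists2 e : R, 0 < e & forall b : A,
    crossed_norm (real_points_val a - real_points_val b) < e -> B b.
Proof.
split.
  move=> [_ [[O oO <-] Oa] OB].
  have : nbhs (real_points_val a) O by apply: open_nbhs_nbhs.
  move=> /nbhs_ballP [e /= /gt0_complexE [r r0 ->]] eO; exists r => // b ab.
  apply: OB; apply: eO; rewrite -ball_normE /ball_ /= .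
  by rewrite ltcR.
move=> [e e0 eB].
have hb : nbhs (real_points_val a) (ball (real_points_val a) (e%:C : R[i])).
  by apply: nbhsx_ballx; rewrite ltcR.
exists (@real_points_val R Z @^-1` (ball (real_points_val a) (e%:C : R[i]))^°); first split; last first.
- move=> b /interior_subset; rewrite -ball_normE /ball_ /= => ab.
  by apply: eB; rewrite -ltcR.
- exact: hb.
- by exists (ball (real_points_val a) (e%:C : R[i]))^°; first exact: open_interior.
Qed.

Lemma closed_real_pointsP (S : set A) : closed S <->
  forall a : A, (forall e : R, 0 < e -> exists2 b, S b &
    crossed_norm (real_points_val a - real_points_val b) < e) -> S a.
Proof.
split=> [cS a ha|h a clS].
  apply: cS => B /nbhs_real_pointsP [e e0 eB].
  by have [b Sb ab] := ha e e0; exists b; split=> //; exact: eB.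
apply: h => e e0.
have [|b [Sb ab]] :=
    clS [set b | crossed_norm (real_points_val a - real_points_val b) < e].
  by apply/nbhs_real_pointsP; exists e.
by exists b.
Qed.

Lemma closed_uniform (S : set A) a : closed S ->
  (forall e : R, 0 < e -> exists2 b, S b & forall z,
    `|even_part a z - even_part b z| <= e%:C /\
    `|odd_part a z - odd_part b z| <= e%:C) ->
  S a.
Proof.
move=> /closed_real_pointsP cS h; apply: cS => e e0.
(* Entries bounded by B give operator norm at most 4 B by [l2norm_mulmx_bound]; the divisor 5 makes
   the inequality strict. *)
have [|b Sb ab] := h (e / 5); first by rewrite divr_gt0.
exists b => //; apply: (@le_lt_trans _ _ (4 * (e / 5))); last by lra.
apply: crossed_norm_le => [|z v]; first by rewrite mulr_ge0// ltW// divr_gt0.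
apply: l2norm_mulmx_bound => i j.
have [h1 h2] := ab z; have [h3 h4] := ab (tau z).
by move: i j; apply: ord2; apply: ord2; rewrite regular_repE -lecR.
Qed.

End Parts.

(** * From pointwise to global membership in an ideal *)
Section LocalToGlobal.
Variables (R : realType) (Z : TZ2_space R).
Local Notation A := (real_points_algebra Z).
Implicit Types (f g a b : A) (z : Z) (w : circle R).

(* Built from moduli, hence invariant under the whole action. *)
Definition gauge f z : R :=
  complex.Re `|even_part f z| + complex.Re `|odd_part f z| +
  (complex.Re `|even_part f (tau z)| + complex.Re `|odd_part f (tau z)|).

Lemma gauge_circle f w z : gauge f (circle_act w z) = gauge f z.
Proof.
by rewrite /gauge tau_rot !even_part_invariant !odd_part_equivariant !normrM
  !circle_valE !mul1r.
Qed.

Lemma gauge_tau f z : gauge f (tau z) = gauge f z.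
Proof. by rewrite /gauge tauK addrC. Qed.

Lemma gauge_continuous f : continuous (gauge f).
Proof.
have c (h : CZ Z) : continuous (fun z => complex.Re `|h z| : R).
  move=> z; apply: (@Re_continuous R Z (fun z => `|h z|)).
  exact: (normC_continuous (@CZ_continuous _ _ h)).
have ct (h : CZ Z) : continuous (fun z => complex.Re `|h (tau z)| : R).
  exact: (comp_continuous (@tau_continuous R Z) (c h)).
by move=> z; apply: cvgD; apply: cvgD; [exact: c|exact: c|exact: ct|exact: ct].
Qed.

Lemma norm_le_gauge f z :
  `|even_part f z| <= (gauge f z)%:C /\ `|odd_part f z| <= (gauge f z)%:C.
Proof.
have h (x : R[i]) : 0 <= complex.Re `|x| by have := normC_Re x; apply: le_trans.
have E (x : R[i]) : `|x| = (complex.Re `|x|)%:C by rewrite normc_def.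
have := h (even_part f z); have := h (odd_part f z).
have := h (even_part f (tau z)).
have := h (odd_part f (tau z)) => h1 h2 h3 h4.
by split; rewrite E lecR /gauge; lra.
Qed.

Variable X : quantum_subspace Z.

Lemma qs_sum (I : Type) (s : seq I) (P : pred I) (F : I -> A) :
  (forall i, P i -> qs_ideal X (F i)) -> qs_ideal X (\sum_(i <- s | P i) F i).
Proof.
by move=> h; elim/big_ind: _ => //; [exact: qs0 | exact: qsD].
Qed.

(* Local solutions are glued by a partition of unity made of gauges. *)
Lemma qs_local a :
  (forall z, exists2 b, qs_ideal X b & rep b z = rep a z) -> qs_ideal X a.
Proof.
move=> loc; apply: (closed_uniform (@qs_closed _ _ X)) => e e0.
pose f b := [set z | qs_ideal X b /\ gauge (a - b) z < e].
have [||s hs] := @compact_finite_cover Z A setT f.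
- exact: TZ2_compact.
- move=> z _; have [b Xb /rep_eqP [h1 h2 h3 h4]] := loc z; exists b.
  have g0 : gauge (a - b) z < e.
    by rewrite /gauge !partE h1 h2 h3 h4 !subrr normr0 !addr0.
  have : \forall t \near z, gauge (a - b) t < e.
    by apply: (cvgr_lt (gauge (a - b) z)) => //; exact: gauge_continuous.
  by apply: filterS => t ht; split.
(* The covering sequence may contain elements outside the ideal, whose cover sets are empty; they
   are discarded. *)
pose s' := [seq b <- s | `[< qs_ideal X b >]].
pose h b z := Num.max 0 (e - gauge (a - b) z).
pose S z := \sum_(b <- s') h b z.
have h0 b z : 0 <= h b z by rewrite le_max lexx.
have Spos z : 0 < S z.
  have [b bs [Xb gb]] := hs z Logic.I.
  have bs' : b \in s' by rewrite mem_filter bs andbT; apply/asboolP.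
  rewrite /S (big_rem b)//=; apply: ltr_pwDl; last exact: sumr_ge0.
  by rewrite lt_max subr_gt0 gb orbT.
have ch b : continuous (h b).
  apply: (@max_fun_continuous _ Z R (fun=> 0) (fun z => e - gauge (a - b) z)).
    by move=> z; exact: cvg_cst.
  by move=> z; apply: cvgB; [exact: cvg_cst | exact: gauge_continuous].
have cS (t : seq A) : continuous (fun z => \sum_(b <- t) h b z).
  elim: t => [|b t IH].
    rewrite (_ : (fun z => _) = (fun=> 0)); first by move=> z; exact: cvg_cst.
    by apply/funext => z; rewrite big_nil.
  rewrite (_ : (fun z => _) = (fun z => h b z + \sum_(c <- t) h c z)).
    by move=> z; apply: cvgD; [exact: ch | exact: IH].
  by apply/funext => z; rewrite big_cons.
have cphi b : continuous (fun z => (h b z / S z) +i* 0 : Cplx R).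
  apply: complex_continuous; last by move=> z; exact: cvg_cst.
  move=> z; apply: cvgM; first exact: ch.
  by apply: cvgV; [rewrite gt_eqF | exact: (cS s')].
have phiE b z : mk_CZ (cphi b) z = (h b z / S z)%:C by [].
have phi_inv b : CZ_invariant (mk_CZ (cphi b)).
  move=> w z; rewrite !phiE /S /h !gauge_circle; congr (_ / _)%:C.
  by apply: eq_bigr => c _; rewrite gauge_circle.
pose phi b := mk_even (phi_inv b).
have phi1 z : \sum_(b <- s') even_part (phi b) z = 1.
  have -> : \sum_(b <- s') even_part (phi b) z = \sum_(b <- s') (h b z / S z)%:C.
    by [].
  rewrite -rmorph_sum -mulr_suml -/(S z) divff ?gt_eqF ?Spos//.
exists (\sum_(b <- s') phi b * b).
  rewrite big_seq_cond; apply: qs_sum => b; rewrite mem_filter andbT.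
  by move=> /andP[/asboolP Xb _]; exact: qsMl.
move=> z; rewrite even_part_sum odd_part_sum.
(* A weighted mean of the values [u b]: the weight of [b] vanishes unless the gauge of [a - b] at
   [z] is below [e], so only values close to [u a] count. *)
have key (u : A -> R[i]) : (forall b, `|u a - u b| <= (gauge (a - b) z)%:C) ->
    `|u a - \sum_(b <- s') even_part (phi b) z * u b| <= e%:C.
  move=> hu; rewrite -[u a]mul1r -(phi1 z) mulr_suml -sumrB.
  apply: le_trans (ler_norm_sum _ _ _) _.
  rewrite -[e%:C]mul1r -(phi1 z) mulr_suml; apply: ler_sum => b _.
  rewrite -mulrBr normrM -[even_part (phi b) z]/((h b z / S z)%:C).
  have q0 : 0 <= h b z / S z by rewrite divr_ge0// ltW.
  rewrite ger0_norm ?lecR//.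
  have [lt_ge|ge_ge] := ltP (gauge (a - b) z) e.
    apply: ler_wpM2l; first by rewrite lecR.
    by apply: le_trans (hu b) _; rewrite lecR ltW.
  rewrite /h max_l ?subr_le0// mul0r !mul0r//.
split.
  under eq_bigr => b _.
    (* [phi b] has zero odd part, so it multiplies both parts of [b] by the same weight. *)
    rewrite partE [X in _ + X](_ : _ = 0) ?addr0; last by rewrite mul0r.
    over.
  apply: (key (fun f => even_part f z)) => b.
  by have [] := norm_le_gauge (a - b) z.
under eq_bigr => b _.
  rewrite partE [X in _ + X](_ : _ = 0) ?addr0; last by rewrite mul0r.
  over.
apply: (key (fun f => odd_part f z)) => b.
by have [] := norm_le_gauge (a - b) z.
Qed.

End LocalToGlobal.

(** * Values of an ideal at a point *)
Section Ideals.
Variables (R : realType) (Z : TZ2_space R).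
Hypothesis Zfree : free_circle_action Z.
Local Notation A := (real_points_algebra Z).
Implicit Types (f g a b c : A) (x y z : Z) (w : circle R).

(** The simplicity of the matrix algebra: two-sided multiplication carries any single entry to any
    place. *)
Lemma delta_mulmx_delta (M : 'M[R[i]]_2) (k i j l : 'I_2) :
  delta_mx k i *m M *m delta_mx j l = M i j *: delta_mx k l.
Proof.
rewrite -(mul_delta_mx 0 k i : _ *m (delta_mx 0 i : 'M_(1, 2)) = _).
rewrite -(mul_delta_mx 0 j l : (delta_mx j 0 : 'M_(2, 1)) *m _ = _).
rewrite -!mulmxA (mulmxA M) (mulmxA (delta_mx 0 i)) (mulmxA _ M).
rewrite -rowE -colE (mx11_scalar (col j (row i M))) !mxE.
by rewrite mul_scalar_mx -scalemxAr mul_delta_mx.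
Qed.

(** An equivariant [f] with values 1 at [z] and 0 at [tau z] gives an odd element represented by an
    off-diagonal unit. Its adjoint gives the other one, and their products the diagonal units. *)
Lemma matrix_units z : Z_reg z ->
  exists u : 'I_2 -> 'I_2 -> A, forall i j, rep (u i j) z = delta_mx i j.
Proof.
move=> zr; have [f [fe fz ftz]] := equivariant_separation Zfree zr.
have fe' : CZ_equivariant (CZ_tau (CZ_star f)).
  by move=> w y; rewrite !CZE tau_rot fe rmorphM /= conjcK.
have r01 : rep (mk_odd fe) z = delta_mx 0 1.
  by apply/matrixP; apply: ord2; apply: ord2; rewrite !repE !mxE.
have r10 : rep (mk_odd fe') z = delta_mx 1 0.
  apply/matrixP; apply: ord2; apply: ord2; rewrite !repE !mxE //=.
    by rewrite -[LHS]/((f (tau z))^*%C) ftz conjc0.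
  by rewrite -[LHS]/((f (tau (tau z)))^*%C) tauK fz conjc1.
have ex i j : exists u : A, rep u z = delta_mx i j.
  move: i j; apply: ord2; apply: ord2.
  - by exists (mk_odd fe * mk_odd fe'); rewrite repM r01 r10 mul_delta_mx.
  - by exists (mk_odd fe).
  - by exists (mk_odd fe').
  - by exists (mk_odd fe' * mk_odd fe); rewrite repM r01 r10 mul_delta_mx.
have /choice [u hu] : forall p : 'I_2 * 'I_2, exists u : A,
    rep u z = delta_mx p.1 p.2.
  by move=> [i j]; exact: ex.
by exists (fun i j => u (i, j)) => i j; exact: hu (i, j).
Qed.

Section LocalSolutions.
Variable X : quantum_subspace Z.

Definition vanishing_reg : set Z :=
  [set z | Z_reg z /\ forall f, qs_ideal X f -> rep f z = 0].
(** Only the character f0 + f1 is tested at [x]; the other one, f0 - f1, is the value of f0 + f1 at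
    -x, so [x] and -x are recorded independently. *)
Definition vanishing_real : set Z :=
  [set x | Z_real x /\
    forall f, qs_ideal X f -> even_part f x + odd_part f x = 0].

Lemma rep_sum (I : Type) (s : seq I) (F : I -> A) z :
  rep (\sum_(i <- s) F i) z = \sum_(i <- s) rep (F i) z.
Proof.
exact: (big_morph (fun f => rep f z) (fun f g => repD f g z) (rep0 z)).
Qed.

(** Some element of the ideal has a nonzero entry at [z]; matrix units spread that entry to all
    places, and scalars adjust it to the entries of [a]. *)
Lemma qs_solve_reg a z : Z_reg z -> ~ vanishing_reg z ->
  exists2 b, qs_ideal X b & rep b z = rep a z.
Proof.
move=> zr zX; have [u hu] := matrix_units zr.
have [c [Xc c0]] : exists c, qs_ideal X c /\ rep c z != 0.
  apply: contrapT => h; apply: zX; split=> // f Xf.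
  by have [//|f0] := eqVneq (rep f z) 0; case: h; exists f.
have [i [j cij]] : exists i j, rep c z i j != 0.
  apply: contrapT => h; move/eqP: c0; apply.
  apply/matrixP => i j; rewrite [RHS]mxE.
  by have [//|cij] := eqVneq (rep c z i j) 0; case: h; exists i, j.
exists (\sum_k \sum_l (rep a z k l / rep c z i j) *: (u k i * c * u j l)).
  apply: qs_sum => k _; apply: qs_sum => l _.
  by apply: qsZ; apply: qsMr; exact: qsMl.
rewrite rep_sum [RHS]matrix_sum_delta; apply: eq_bigr => k _.
rewrite rep_sum; apply: eq_bigr => l _.
by rewrite repZ !repM !hu delta_mulmx_delta scalerA divfK.
Qed.

(** The two equal halves say that [b] agrees with [a] under the character at [x] and vanishes under
    the one at -x. *)
Lemma qs_solve_char a x : Z_real x ->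
  (vanishing_real x -> even_part a x + odd_part a x = 0) ->
  exists b, [/\ qs_ideal X b,
    even_part b x = (even_part a x + odd_part a x) / 2 &
    odd_part b x = (even_part a x + odd_part a x) / 2].
Proof.
move=> xr ha; have [Xx|Xx] := pselect (vanishing_real x).
  by exists 0; split; [exact: qs0 | |]; rewrite ha// mul0r.
have [c [Xc c0]] : exists c, qs_ideal X c /\ even_part c x + odd_part c x != 0.
  apply: contrapT => h; apply: Xx; split=> // f Xf.
  by have [//|f0] := eqVneq (even_part f x + odd_part f x) 0; case: h; exists f.
have [g ge gx] := equivariant_section Zfree x.
have u0 : even_part (mk_odd ge) x = 0 by [].
have u1 : odd_part (mk_odd ge) x = 1 by [].
pose t := (even_part a x + odd_part a x) / (even_part c x + odd_part c x) / 2.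
(* The factor 1 + g, with g odd and equal to 1 at [x], takes the value 2 under the character at [x]
   and 0 under that at -x; [t] normalises the result. *)
exists (t *: (c + mk_odd ge * c)); split.
- by apply: qsZ; apply: qsD => //; exact: qsMl.
- rewrite even_partZ even_partD even_partM.
  by rewrite u0 u1 (xr : tau x = x) mul0r add0r mul1r /t mulrAC divfK.
- rewrite odd_partZ odd_partD odd_partM u0 u1 (xr : tau x = x) mul0r add0r mul1r.
  by rewrite [odd_part c x + _]addrC /t mulrAC divfK.
Qed.

Lemma circle_opp_subproof : `|-1 : R[i]| = 1.
Proof. by rewrite normrN1. Qed.

Definition circle_opp : circle R := mk_circle circle_opp_subproof.

(** Solutions for the characters at [x] and at -x are added; agreement at [x] then propagates along
    its orbit by equivariance. *)
Lemma qs_solve_real a x w : Z_real x ->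
  (forall y, vanishing_real y -> even_part a y + odd_part a y = 0) ->
  exists2 b, qs_ideal X b & rep b (circle_act w x) = rep a (circle_act w x).
Proof.
move=> xr ha; pose y := circle_act circle_opp x.
have yr : Z_real y.
  rewrite /Z_real /= tau_rot (xr : tau x = x); congr circle_act.
  by apply: circle_val_inj; exact: rmorphN1.
have ey f : even_part f y = even_part f x by rewrite /y even_part_invariant.
have oy f : odd_part f y = - odd_part f x.
  by rewrite /y odd_part_equivariant mulN1r.
have [b [Xb b0 b1]] := qs_solve_char xr (ha x).
have [c [Xc c0 c1]] := qs_solve_char yr (ha y).
rewrite ey ey oy in c0; rewrite oy oy ey in c1.
have h0 : even_part (b + c) x = even_part a x by rewrite partE b0 c0; field.
have h1 : odd_part (b + c) x = odd_part a x.
  by rewrite partE b1 -[odd_part c x]opprK c1; field.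
exists (b + c); first exact: qsD.
apply/rep_eqP; rewrite tau_rot (xr : tau x = x).
by rewrite !even_part_invariant !odd_part_equivariant h0 h1.
Qed.

(** This gives the injectivity of the correspondence. A point off [Z_reg] is by definition a
    rotation of a real point, so the two kinds of local solution cover [Z]. *)
Lemma qs_ideal_vanishing a :
  (forall z, vanishing_reg z -> rep a z = 0) ->
  (forall x, vanishing_real x -> even_part a x + odd_part a x = 0) ->
  qs_ideal X a.
Proof.
move=> areg areal; apply: qs_local => z.
have [zr|] := pselect (Z_reg z).
  have [Xz|Xz] := pselect (vanishing_reg z); last exact: qs_solve_reg.
  by exists 0; [exact: qs0 | rewrite rep0 areg].
move=> /contrapT [w [x [xr ->]]]; exact: qs_solve_real.
Qed.

End LocalSolutions.
End Ideals.

(** * The correspondence *)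
Section Correspondence.
Variables (R : realType) (Z : TZ2_space R).
Local Notation A := (real_points_algebra Z).
Local Notation normc := (@ComplexField.Normc.normc R).
Implicit Types (f g a b c : A) (x y z : Z) (w : circle R) (h k : CZ Z).

Lemma TZ2_actE (g : TZ2 R) z :
  TZ2_act g z = circle_act g.1 (if g.2 then tau z else z).
Proof.
case: g => w [] /=; last by [].
rewrite /circle_act /tau -TZ2_actM; congr TZ2_act.
transitivity (TZ2_mul (w, false) (TZ2_flip R)); last by [].
by rewrite /TZ2_mul /= mulg1.
Qed.

Lemma Z_reg_act (g : TZ2 R) z : Z_reg z -> Z_reg (TZ2_act g z).
Proof.
move=> zr [w [x [xr E]]]; apply: zr.
have -> : z = TZ2_act (g^-1)%g (circle_act w x).
  by rewrite -E -TZ2_actM mulVg TZ2_act1.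
rewrite TZ2_actE; case: ifP => _; last first.
  by exists ((g^-1)%g.1 * w)%g, x; rewrite circle_actM.
exists ((g^-1)%g.1 * circle_conj w)%g, x.
by rewrite tau_rot (xr : tau x = x) circle_actM.
Qed.

(** The zeros of the matrix become those of one continuous real function invariant under the whole
    group, which yields their stability and closedness. *)
Lemma gauge_eq0 f z : gauge f z = 0 <-> rep f z = 0.
Proof.
rewrite -(rep0 z) rep_eqP; split=> [f0|[h1 h2 h3 h4]]; last first.
  by rewrite /gauge h1 h2 h3 h4 normr0 !addr0.
have [h1 h2] := norm_le_gauge f z; have [h3 h4] := norm_le_gauge f (tau z).
move: h1 h2 h3 h4; rewrite gauge_tau f0 !normr_le0.
by move=> /eqP-> /eqP-> /eqP-> /eqP->.
Qed.

Lemma rep_act f (g : TZ2 R) z : rep f z = 0 -> rep f (TZ2_act g z) = 0.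
Proof.
rewrite -!gauge_eq0 TZ2_actE gauge_circle.
by case: ifP => _; rewrite ?gauge_tau.
Qed.

Lemma rep_zeros_closed f : closed [set z | rep f z = 0].
Proof.
have -> : [set z | rep f z = 0] = gauge f @^-1` [set r | r = 0].
  by apply/seteqP; split=> z /gauge_eq0.
apply: preimage_closed; last exact: closed_eq.
by move=> z _; exact: gauge_continuous.
Qed.

Lemma CZ_zeros_closed h : closed [set z | h z = 0].
Proof.
have -> : [set z | h z = 0] = (h : Z -> Cplx R) @^-1` [set 0] by [].
apply: preimage_closed; first by move=> z _; exact: CZ_continuous.
apply: accessible_closed_set1; apply: hausdorff_accessible.
exact: (@norm_hausdorff R[i] (Cplx R)).
Qed.

Lemma Z_real_closed : closed (@Z_real R Z).
Proof.
move=> x clx; apply: TZ2_hausdorff => U V Ux Vx.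
have tU : nbhs x (tau @^-1` U) by exact: (@tau_continuous R Z x U Ux).
have [y [yr [/= Uy Vy]]] := clx _ (filterI tU Vx).
by exists y; split=> //; rewrite -(yr : tau y = y).
Qed.

(** * From ideals to pairs *)

Section PairOfIdeal.
Variable X : quantum_subspace Z.

Lemma closure_vanishing_reg f z :
  qs_ideal X f -> closure (vanishing_reg X) z -> rep f z = 0.
Proof.
move=> Xf clz; apply: (@rep_zeros_closed f z).
by apply: closure_subset clz => y [_]; exact.
Qed.

Lemma vanishing_reg_stable (g : TZ2 R) z :
  vanishing_reg X z -> vanishing_reg X (TZ2_act g z).
Proof.
by move=> [zr Xz]; split=> [|f Xf]; [exact: Z_reg_act | exact: rep_act (Xz f Xf)].
Qed.

Lemma vanishing_reg_closed :
  vanishing_reg X = closure (vanishing_reg X) `&` Z_reg.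
Proof.
apply/seteqP; split=> [z Xz|z [clz zr]].
  by split; [exact: subset_closure | case: Xz].
by split=> // f Xf; exact: closure_vanishing_reg clz.
Qed.

Lemma vanishing_real_closed : closed (vanishing_real X).
Proof.
move=> x clx; split.
  by apply: Z_real_closed; apply: closure_subset clx => y [].
move=> f Xf; apply: (@CZ_zeros_closed (even_part f + odd_part f) x).
by apply: closure_subset clx => y [_ /(_ f Xf)].
Qed.

Lemma closure_vanishing_reg_real :
  closure (vanishing_reg X) `&` Z_real `<=` vanishing_real X.
Proof.
move=> x [clx xr]; split=> // f Xf.
have := closure_vanishing_reg Xf clx; rewrite -(rep0 x) => /rep_eqP [-> -> _ _].
by rewrite addr0.
Qed.

Definition pair_of_ideal : EF_pair Z :=
  @EFPair R Z (vanishing_reg X) (vanishing_real X) (fun z => @proj1 _ _)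
    vanishing_reg_stable vanishing_reg_closed (fun x => @proj1 _ _)
    vanishing_real_closed closure_vanishing_reg_real.

End PairOfIdeal.

(** * From pairs to ideals *)

Section IdealOfPair.
Variable P : EF_pair Z.

Definition pair_vanishing : set A :=
  [set f | (forall z, EF_E P z -> rep f z = 0) /\
    forall x, EF_F P x -> even_part f x + odd_part f x = 0].

Lemma pair_vanishing_closed : closed pair_vanishing.
Proof.
apply/closed_real_pointsP => a ha.
have le_dist b z i j e :
    crossed_norm (real_points_val a - real_points_val b) < e ->
    normc (rep (a - b) z i j) <= e.
  have <- : real_points_val (a - b) = real_points_val a - real_points_val b by [].
  by move=> /ltW; apply: le_trans; exact: norm_rep_le.
have small (u : R[i]) : (forall e : R, 0 < e -> normc u <= e) -> u = 0.
  move=> hu; apply: ComplexField.Normc.eq0_normc; apply: le_anti.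
  apply/andP; split; last by case: u {hu} => p q; exact: sqrtr_ge0.
  by apply/ler_addgt0Pr => e e0; rewrite add0r hu.
split=> z Pz.
  apply/matrixP => i j; rewrite [RHS]mxE; apply: small => e e0.
  have [b [bE _] ab] := ha e e0.
  have -> : rep a z = rep (a - b) z
    by rewrite -[RHS]addr0 -(bE z Pz) -repD subrK.
  exact: le_dist.
apply: small => e e0; have [|b [_ bF] ab] := ha (e / 2); first by rewrite divr_gt0.
have -> : even_part a z + odd_part a z =
    even_part (a - b) z + odd_part (a - b) z.
  by rewrite -[RHS]addr0 -(bF z Pz) addrACA -even_partD -odd_partD subrK.
apply: le_trans (le_normcD _ _) _; rewrite [e]splitr; apply: lerD.
  by rewrite -(repE (a - b) z).1.1.1; exact: le_dist.
by rewrite -(repE (a - b) z).1.1.2; exact: le_dist.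
Qed.

(** As [tau] fixes real points, the twist in the crossed product disappears there and the sum of the
    two parts is a character. *)
Let char_mul f g x : EF_F P x -> even_part (f * g) x + odd_part (f * g) x =
  (even_part f x + odd_part f x) * (even_part g x + odd_part g x).
Proof.
move=> /EF_F_real xr; rewrite even_partM odd_partM (xr : tau x = x); ring.
Qed.

Lemma pair_vanishingD f g :
  pair_vanishing f -> pair_vanishing g -> pair_vanishing (f + g).
Proof.
move=> [fE fF] [gE gF]; split=> z Pz; first by rewrite repD fE// gE// addr0.
by rewrite even_partD odd_partD addrACA fF// gF// addr0.
Qed.

Lemma pair_vanishingZ (c : R[i]) f : pair_vanishing f -> pair_vanishing (c *: f).
Proof.
move=> [fE fF]; split=> z Pz; first by rewrite repZ fE// scaler0.
by rewrite even_partZ odd_partZ -mulrDr fF// mulr0.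
Qed.

Lemma pair_vanishingMl f g : pair_vanishing g -> pair_vanishing (f * g).
Proof.
move=> [gE gF]; split=> z Pz; first by rewrite repM gE// mulmx0.
by rewrite char_mul// gF// mulr0.
Qed.

Lemma pair_vanishingMr f g : pair_vanishing f -> pair_vanishing (f * g).
Proof.
move=> [fE fF]; split=> z Pz; first by rewrite repM fE// mul0mx.
by rewrite char_mul// fF// mul0r.
Qed.

Lemma pair_vanishing0 : pair_vanishing 0.
Proof. by split=> z _; [exact: rep0 | exact: (addr0 (0 : R[i]))]. Qed.

Definition ideal_of_pair : quantum_subspace Z :=
  QuantumSubspace pair_vanishing_closed pair_vanishing0 pair_vanishingD
    pair_vanishingZ pair_vanishingMl pair_vanishingMr.

Lemma tau_EF_E z : EF_E P z -> EF_E P (tau z).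
Proof. exact: EF_E_stable. Qed.

Lemma circle_act_closure_EF_E w z :
  closure (EF_E P) (circle_act w z) -> closure (EF_E P) z.
Proof.
move=> clz U Uz.
have zE : circle_act (w^-1)%g (circle_act w z) = z.
  by rewrite -circle_actM mulVg circle_act1.
rewrite -zE in Uz.
have nU := @circle_act_continuousr R Z (w^-1)%g (circle_act w z) U Uz.
have [y [Ey Uy]] := clz _ nU; exists (circle_act (w^-1)%g y); split=> //.
exact: EF_E_stable.
Qed.

(** The orbit of [z] avoids the closure of E, since E is stable and closed in [Z_reg], and it avoids
    F, whose points are real. An invariant bump function, taken as an even element, then
    separates. *)
Lemma pair_separation_reg z : Z_reg z -> ~ EF_E P z ->
  exists2 f, pair_vanishing f & rep f z <> 0.
Proof.
move=> zr zE; pose C := closure (EF_E P) `|` EF_F P.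
have [||h [hi hz hC]] := @invariant_urysohn R Z C z.
- by apply: closedU; [exact: closed_closure | exact: EF_F_closed].
- move=> w [/circle_act_closure_EF_E clz|/EF_F_real wr].
    by apply: zE; rewrite EF_E_closed.
  apply: zr; exists (w^-1)%g, (circle_act w z); split=> //.
  by rewrite -circle_actM mulVg circle_act1.
have hE y : EF_E P y -> h y = 0.
  by move=> Ey; apply: hC; left; exact: subset_closure.
exists (mk_even hi); last first.
  move=> /matrixP /(_ 0 0); rewrite repE mxE -[LHS]/(h z) hz.
  by apply/eqP; exact: oner_neq0.
split=> y Py.
  rewrite -(rep0 y); apply/rep_eqP; split=> //.
    exact: hE.
  exact: hE (tau_EF_E Py).
by rewrite -[LHS]/(h y + 0) hC ?addr0//; right.
Qed.

Hypothesis Zfree : free_circle_action Z.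

(* The functions |g| k + g k (x) tau, where g is equivariant and real on the
   real points, vanish under chi_y exactly where k y = 0 or g y <= 0; as g
   changes sign under x |-> -x, this separates x from -x. *)
Lemma pair_separation_real x : Z_real x -> ~ EF_F P x ->
  exists2 f, pair_vanishing f & even_part f x + odd_part f x <> 0.
Proof.
move=> xr xF; have [g0 g0e g0x] := equivariant_section Zfree x.
(* Symmetrising gives g (tau y) = conj (g y), so [g] is real on real points, where it equals the
   real part [r] of [g0]. *)
pose g : CZ Z := 2^-1 *: (g0 + CZ_tau (CZ_star g0)).
have gE y : g y = 2^-1 * (g0 y + (g0 (tau y))^*%C) by [].
have ge : CZ_equivariant g.
  move=> w y; rewrite !gE tau_rot !g0e rmorphM /= conjcK; ring.
pose r y := complex.Re (g0 y).
have greal y : Z_real y -> g y = (r y)%:C.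
  move=> yr; rewrite gE (yr : tau y = y) /r; case: (g0 y) => a b /=.
  by rewrite -(mulr_natl _ 2); simpc; congr (_ +i* _); field.
have cabs : continuous (fun y => `|g y| : Cplx R).
  exact: (normC_continuous (@CZ_continuous _ _ g)).
pose absg := mk_CZ cabs.
have absgE y : absg y = `|g y| by [].
(* Where [r] is negative the character vanishes anyway, so [k] is made to vanish only on the rest of
   F; the weak inequality keeps [C] closed. *)
pose C := closure (EF_E P) `|` (EF_F P `&` [set y | 0 <= r y]).
have [||k [ki kx kC]] := @invariant_urysohn R Z C x.
- apply: closedU; first exact: closed_closure.
  apply: closedI; first exact: EF_F_closed.
  have -> : [set y | 0 <= r y] = r @^-1` [set t | t >= 0].
    by apply/seteqP; split.
  apply: preimage_closed; last exact: closed_ge.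
  by move=> y _; apply: (@Re_continuous R Z (g0 : Z -> Cplx R) y);
    exact: CZ_continuous.
- move=> w [/circle_act_closure_EF_E clx|[wF r0]].
    by apply: xF; apply: EF_E_F.
  (* A rotation w x of the real point [x] is real only if w^2 = 1, by freeness. The case w = 1
     contradicts that [x] is outside F, and w = -1 gives [r] the value -1. *)
  have := EF_F_real wF; rewrite /Z_real /= tau_rot (xr : tau x = x) => wx.
  have {wx} : circle_act (w * w)%g x = x.
    by rewrite circle_actM -wx -circle_actM mulgV circle_act1.
  move=> /Zfree /(congr1 (@circle_val R)) ww.
  have : circle_val w ^+ 2 == 1 by apply/eqP.
  rewrite sqrf_eq1 => /orP[/eqP w1|/eqP w1].
    by apply: xF; rewrite (_ : w = 1%g) ?circle_act1 in wF; last exact: circle_val_inj.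
  by move: r0; rewrite /r /= g0e w1 g0x mulN1r /= lerNr oppr0 ler10.
have ei : CZ_invariant (absg * k).
  by move=> w y; rewrite !(CZME absg k) ki !absgE ge normrM circle_valE mul1r.
have oe : CZ_equivariant (g * k) by move=> w y; rewrite !(CZME g k) ki ge mulrA.
exists (mk_real_points ei oe).
  have kE y : EF_E P y -> k y = 0.
    by move=> Ey; apply: kC; left; exact: subset_closure.
  split=> y Py.
    have ky := kE _ Py; have kty := kE _ (tau_EF_E Py).
    rewrite -(rep0 y); apply/rep_eqP; split.
    - by rewrite -[LHS]/(absg y * k y) ky mulr0.
    - by rewrite -[LHS]/(g y * k y) ky mulr0.
    - by rewrite -[LHS]/(absg (tau y) * k (tau y)) kty mulr0.
    - by rewrite -[LHS]/(g (tau y) * k (tau y)) kty mulr0.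
  rewrite -[LHS]/(absg y * k y + g y * k y) absgE -mulrDl.
  have [r0|r0] := leP 0 (r y); first by rewrite kC ?mulr0//; right.
  rewrite greal ?normc_def /=; last exact: EF_F_real Py.
  rewrite expr0n addr0 sqrtr_sqr ltr0_norm// rmorphN addNr mul0r//.
rewrite -[even_part _ _]/(absg x * k x) -[odd_part _ _]/(g x * k x).
rewrite absgE kx !mulr1 greal// /r g0x normr1.
rewrite -[(_)%:C]/(1 : R[i]) -mulr2n.
by apply/eqP; rewrite pnatr_eq0.
Qed.

End IdealOfPair.

(** * The two constructions are inverse, and commutativity of the quotient *)

Lemma quantum_subspace_ext (X Y : quantum_subspace Z) :
  qs_ideal X = qs_ideal Y -> X = Y.
Proof.
case: X Y => [I1 ? ? ? ? ? ?] [I2 ? ? ? ? ? ?] /= E; subst I2.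
congr QuantumSubspace; exact: Prop_irrelevance.
Qed.

Lemma EF_pair_ext (P Q : EF_pair Z) : EF_E P = EF_E Q -> EF_F P = EF_F Q -> P = Q.
Proof.
case: P Q => [E1 F1 ? ? ? ? ? ?] [E2 F2 ? ? ? ? ? ?] /= h1 h2; subst E2 F2.
congr EFPair; exact: Prop_irrelevance.
Qed.

Lemma qs_commutativeP (X : quantum_subspace Z) :
  commutative ( *%R : qs_algebra X -> _) <->
  forall f g, qs_ideal X (f * g - g * f).
Proof.
split=> [cX f g|cX p q].
  by apply/qs_piP; rewrite !qs_piM; exact: cX.
rewrite -[p]reprK -[q]reprK; move: (repr p) (repr q) => f g.
by rewrite -[LHS]qs_piM -[RHS]qs_piM; apply/qs_piP.
Qed.

Hypothesis Zfree : free_circle_action Z.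

Lemma pair_of_idealK : cancel (@pair_of_ideal) (@ideal_of_pair).
Proof.
move=> X; apply: quantum_subspace_ext; apply/seteqP; split=> f /=.
  by move=> [fE fF]; exact: qs_ideal_vanishing.
by move=> Xf; split=> z [_]; exact.
Qed.

Lemma ideal_of_pairK : cancel (@ideal_of_pair) (@pair_of_ideal).
Proof.
move=> P; apply: EF_pair_ext; apply/seteqP; split=> z /=.
- move=> [zr Xz]; apply: contrapT => /(pair_separation_reg zr) [f Pf].
  by apply; exact: Xz.
- by move=> Ez; split=> [|f [fE _]]; [exact: EF_E_reg Ez | exact: fE].
- move=> [zr Xz]; apply: contrapT => /(pair_separation_real Zfree zr) [f Pf].
  by apply; exact: Xz.
- by move=> Fz; split=> [|f [_ fF]]; [exact: EF_F_real Fz | exact: fF].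
Qed.

(** Without regular points in the vanishing locus, membership in the ideal is tested by characters
    alone, and these kill commutators. At a regular point of the locus the representation factors
    through the quotient and is onto the 2x2 matrices. *)
Lemma non_classicalP (X : quantum_subspace Z) :
  non_classical X <-> vanishing_reg X <> set0.
Proof.
rewrite /non_classical qs_commutativeP; split=> [nX X0|XE cX].
  apply: nX => f g; apply: qs_ideal_vanishing => // [z|x [xr _]].
    by rewrite X0.
  rewrite !(even_partD, odd_partD, even_partN, odd_partN, even_partM, odd_partM).
  by rewrite (xr : tau x = x); ring.
move/eqP/set0P: XE => [z [zr Xz]]; have [u hu] := matrix_units Zfree zr.
(* The commutator of the two off-diagonal units is diag(1, -1), which is not zero. *)
have := Xz _ (cX (u 0 1) (u 1 0)).
rewrite repD -scaleN1r repZ !repM !hu !mul_delta_mx => /matrixP /(_ 0 0).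
by rewrite !mxE /= mulr0 addr0 => /eqP; rewrite oner_eq0.
Qed.

End Correspondence.

Theorem theorem4p5 (R : realType) (Z : TZ2_space R)
    (Zfree : free_circle_action Z) :
  exists Phi : quantum_subspace Z -> EF_pair Z,
    bijective Phi /\
    forall X : quantum_subspace Z, non_classical X <-> EF_E (Phi X) <> set0.
Proof.
exists (@pair_of_ideal R Z); split; last exact: non_classicalP.
by exists (@ideal_of_pair R Z); [exact: pair_of_idealK | exact: ideal_of_pairK].
Qed.
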